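(* Let $W$ be a Coxeter group with simple generators $S$, let $\Omega$ be an orientation of its Coxeter diagram $\Gamma$, let $v\in W$ be $\Omega$-sortable and let $w\in W$. Then $\pi_\downarrow^{\Omega}(w)=v$ if and only if $wD\subseteq \mathrm{Cone}_{\Omega}(v)$.
   Context: Coxeter group and orientation. $W$ is a Coxeter group with finite set $S$ of simple generators; $m(s,t)$ is the order of $st$ (possibly $\infty$), $\ell$ is the length function and $e$ the identity. The (right) weak order on $W$ sets $u\le w$ if and only if $\ell(u)+\ell(u^{-1}w)=\ell(w)$. For $J\subseteq S$, $W_J$ is the standard parabolic subgroup generated by $J$. The Coxeter diagram $\Gamma$ is the graph with vertex set $S$ in which distinct $s,t$ are joined by an edge if and only if they do not commute. $\Omega$ is an arbitrary orientation of $\Gamma$ (each edge is given one direction; directed cycles are allowed). A subset $J\subseteq S$ is $\Omega$-acyclic if the induced subgraph of $\Gamma$ on $J$, oriented by $\Omega$, has no directed cycle. For $\Omega$-acyclic $J$, $c(\Omega,J)=s_1s_2\cdots s_k$, where $s_1,\ldots,s_k$ is any ordering of $J$ such that $i<j$ whenever there is an edge oriented $s_j\to s_i$ (the product does not depend on the ordering; $c(\Omega,\emptyset)=e$). $J(w,\Omega)$ denotes the unique maximal (under inclusion) element among the $\Omega$-acyclic subsets $J'\subseteq S$ with $w\ge c(\Omega,J')$ (it is a fact that there is a unique maximal one, which therefore contains all the others). $\Omega$-sortable elements: given $w\in W$, set $w_1=w$ and, inductively, $J_i=J(w_i,\Omega)$, $w_{i+1}=c(\Omega,J_i)^{-1}w_i$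 (so $J_i=\emptyset$ for $i$ large). The element $w$ is $\Omega$-sortable if $J_1\supseteq J_2\supseteq\cdots$. If $w$ is $\Omega$-sortable then $w\in W_{J(w,\Omega)}$. For $w\in W$, $\mathrm{inv}(w)$ is the set of reflections $t$ (conjugates of elements of $S$) with $\ell(tw)<\ell(w)$. For $J\subseteq S$, $w_J$ is the unique element of $W_J$ with $\mathrm{inv}(w_J)=\mathrm{inv}(w)\cap W_J$. The map $\pi_\downarrow^\Omega:W\to W$ is defined recursively by $\pi_\downarrow^\Omega(e)=e$ and, for $w\neq e$, with $J=J(w,\Omega)$, $\pi_\downarrow^{\Omega}(w)=c(\Omega,J)\,\pi_\downarrow^{\Omega}\bigl(c(\Omega,J)^{-1}w_J\bigr)$. Reflection representation. Fix a symmetrizable generalized Cartan matrix $A$ for $W$: a real $S\times S$ matrix with $A_{ss}=2$; $A_{ss'}\le 0$ for $s\ne s'$, with $A_{ss'}A_{s's}=4\cos^2(\pi/m(s,s'))$ if $m(s,s')<\infty$ and $A_{ss'}A_{s's}\ge 4$ if $m(s,s')=\infty$; $A_{ss'}=0$ if and only if $A_{s's}=0$; and such that there is a positive function $\delta$ on $S$ with $\delta(s)A_{ss'}=\delta(s')A_{s's}$ for all $s,s'$ and $\delta(s)=\delta(s')$ whenever $s,s'$ are conjugate in $W$. Let $V$ be the real vector space with basis $\{\alpha_s:s\in S\}$ (the simple roots), with $W$ acting by $s(\alpha_{s'})=\alpha_{s'}-A_{ss'}\alpha_s$; $W$ acts on the dual space $V^*$ by the dual action, and $\langle\cdot,\cdot\rangle$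 is the pairing between $V^*$ and $V$. The dominant chamber is $D=\bigcap_{s\in S}\{x^*\in V^*:\langle x^*,\alpha_s\rangle\ge 0\}$. The vectors $C_\Omega^r(v)$ and the cone. Let $K\subseteq S$ be $\Omega$-acyclic, let $c=c(\Omega,K)$ with reduced word $s_1\cdots s_n$ (each element of $K$ appearing once), and let $u\in W_K$. The $(s_1\cdots s_n)$-sorting word for $u$ is the lexicographically first (as a sequence of positions) subword of the infinite word $(s_1\cdots s_n)^\infty=s_1\cdots s_n\,s_1\cdots s_n\cdots$ that is a reduced word for $u$. Write it $a_1a_2\cdots a_k$; it occupies a specific set of positions. For $r\in K$, consider the first occurrence of $r$ in $(s_1\cdots s_n)^\infty$ that is not in a position occupied by $a_1\cdots a_k$, and let this occurrence lie between $a_i$ and $a_{i+1}$ ($0\le i\le k$, with the obvious meaning for $i=0$ and $i=k$). Define $C_c^r(u)=a_1a_2\cdots a_i\,\alpha_r\in V$. Now let $v$ be $\Omega$-sortable and $J=J(v,\Omega)$. For $r\in S$, if $J\cup\{r\}$ is $\Omega$-acyclic, define $C_\Omega^r(v)=C^r_{c(\Omega,J\cup\{r\})}(v)$; otherwise $C_\Omega^r(v)$ is undefined. Set $\mathrm{Cone}_\Omega(v)=\bigcap_r\{x^*\in V^*:\langle x^*,C_\Omega^r(v)\rangle\ge 0\}$, the intersection being over those $r\in S$ such that $C_\Omega^r(v)$ is defined. *)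

(* Defs.v *)
From HB Require Import structures.
From mathcomp Require Import all_boot all_order all_algebra.
From mathcomp Require Import all_classical all_reals trigo.
Set Implicit Arguments.
Unset Strict Implicit.
Unset Printing Implicit Defensive.
Import Order.TTheory GRing.Theory Num.Theory.
Local Open Scope classical_set_scope.
Local Open Scope ring_scope.

Section Words.
Variables (W : groupType) (S : finType) (gen : S -> W).

Definition word_prod (u : seq S) : W := (\prod_(s <- u) gen s)%g.

(* The congruence on words generated by (s t)^(m s t) ~ 1, where m s t = 0
   stands for an infinite order and so gives no relation. Since m s s = 1
   includes s s ~ 1, inverses are not needed and this is the word problem
   of the Coxeter presentation. *)
Inductive coxeter_equiv (m : S -> S -> nat) : seq S -> seq S -> Prop :=
| coxeter_rel s t :
    coxeter_equiv m (flatten (nseq (m s t) [:: s; t])) [::]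
| coxeter_refl u : coxeter_equiv m u u
| coxeter_sym u v : coxeter_equiv m u v -> coxeter_equiv m v u
| coxeter_trans u v x :
    coxeter_equiv m u v -> coxeter_equiv m v x -> coxeter_equiv m u x
| coxeter_cat u u' v v' : coxeter_equiv m u u' -> coxeter_equiv m v v' ->
    coxeter_equiv m (u ++ v) (u' ++ v').

End Words.

(* W is a Coxeter group with simple generators gen s (s : S). The number
   cox_m s t is the order of st, with 0 standing for infinity. *)
Record coxeterSystem (W : groupType) (S : finType) := CoxeterSystem {
  gen : S -> W;
  cox_m : S -> S -> nat;
  cox_m_eq1 : forall s t, (cox_m s t == 1%N) = (s == t);
  cox_m_order : forall s t k,
    ((gen s * gen t) ^+ k = 1)%g <-> (cox_m s t %| k)%N;
  cox_generated : forall w : W, exists u : seq S, word_prod gen u = w;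
  cox_presentation : forall u v : seq S,
    word_prod gen u = word_prod gen v <-> coxeter_equiv cox_m u v
}.

Section Coxeter.
Variables (W : groupType) (S : finType) (C : coxeterSystem W S).

Local Notation wp := (word_prod (gen C)).

Lemma ex_word_size (w : W) :
  exists n, [exists u : n.-tuple S, wp u == w].
Proof.
have [u uw] := cox_generated C w.
by exists (size u); apply/existsP; exists (in_tuple u); apply/eqP.
Qed.

Definition length (w : W) : nat := ex_minn (ex_word_size w).

Definition reduced_word_of (w : W) (u : seq S) : Prop :=
  wp u = w /\ size u = length w.

Definition weak_le (u w : W) : bool :=
  (length u + length (u^-1 * w)%g == length w)%N.

(* As the generators are involutions, the subgroup generated by J consists
   of the products of words in J. *)
Definition parabolic (J : {set S}) : set W :=
  [set w | exists u : seq S, {subset u <= J} /\ wp u = w].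

Definition reflection (t : W) : Prop :=
  exists (x : W) (s : S), t = (gen C s ^ x)%g.

Definition inversions (w : W) : set W :=
  [set t | reflection t /\ (length (t * w)%g < length w)%N].

Definition parabolic_part (J : {set S}) (w : W) : W :=
  xget 1%g [set x | parabolic J x /\ inversions x = inversions w `&` parabolic J].

Definition diagram : rel S :=
  fun s t => (s != t) && ((gen C s * gen C t)%g != (gen C t * gen C s)%g).

(* orient s t means that there is an edge oriented s -> t. *)
Record orientation := Orientation {
  orient :> rel S;
  orient_diagram : forall s t, orient s t -> diagram s t;
  orient_one : forall s t, diagram s t -> orient s t = ~~ orient t s
}.

Variable Om : orientation.

Definition acyclic (J : {set S}) : bool :=
  `[< forall p : seq S, p != [::] -> {subset p <= J} -> ~~ cycle Om p >].

Definition acyclic_order (J : {set S}) (p : seq S) : Prop :=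
  [/\ uniq p, p =i J &
      {in J &, forall s t, Om s t -> (index t p < index s p)%N}].

(* An arbitrary choice among the orderings of J: two of them differ only by
   commutations. *)
Definition cword (J : {set S}) : seq S :=
  xget [::] [set p | acyclic_order J p].

Definition cOm (J : {set S}) : W := wp (cword J).

Definition Jmax (w : W) : {set S} :=
  odflt finset.set0
    [pick J | maxset (fun J' => acyclic J' && weak_le (cOm J') w) J].

Definition sort_step (w : W) : W := ((cOm (Jmax w))^-1 * w)%g.

Definition sortable (v : W) : Prop :=
  forall i : nat,
    Jmax (iter i.+1 sort_step v) \subset Jmax (iter i sort_step v).

(* The recursion defining the projection strictly decreases the length, so
   length w steps suffice. *)
Fixpoint pi_down_rec (n : nat) (w : W) : W :=
  if n is n'.+1 then
    if w == 1%g then 1%g else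
    let J := Jmax w in
    (cOm J * pi_down_rec n' ((cOm J)^-1 * parabolic_part J w))%g
  else 1%g.

Definition pi_down (w : W) : W := pi_down_rec (length w) w.

(* The i-th letter (from 0) of the infinite word q q q ...; the default value
   s0 is used only if q is empty. *)
Definition letter (q : seq S) (s0 : S) (i : nat) : S :=
  nth s0 q (i %% size q)%N.

(* P lists the positions of a subword of q q q ... that is a reduced word
   for u. *)
Definition reduced_positions q s0 (u : W) (P : seq nat) : Prop :=
  sorted ltn P /\ reduced_word_of u (map (letter q s0) P).

Definition sorting_positions q s0 (u : W) : seq nat :=
  xget [::] [set P | reduced_positions q s0 u P /\
    forall P', reduced_positions q s0 u P' ->
      ((P : seqlexi nat) <= (P' : seqlexi nat))%O].

Definition first_skip q (r : S) (P : seq nat) : nat :=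
  xget 0%N [set j | [/\ letter q r j = r, j \notin P &
    forall j', letter q r j' = r -> j' \notin P -> (j <= j')%N]].

Section Representation.
Variables (R : realType) (A : S -> S -> R).

Record symmetrizable_cartan : Prop := SymmetrizableCartan {
  cartan_diag : forall s, A s s = 2;
  cartan_offdiag : forall s t, s != t -> A s t <= 0;
  cartan_finite : forall s t, s != t -> cox_m C s t != 0%N ->
    A s t * A t s = 4 * cos (pi / (cox_m C s t)%:R) ^+ 2;
  cartan_infinite : forall s t, s != t -> cox_m C s t = 0%N ->
    4 <= A s t * A t s;
  cartan_zero : forall s t, A s t = 0 <-> A t s = 0;
  cartan_symm : exists delta : S -> R,
    [/\ forall s, 0 < delta s,
        forall s t, delta s * A s t = delta t * A t s &
        forall s t, (exists x : W, gen C t = (gen C s ^ x)%g) ->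
          delta s = delta t]
}.

Definition rootV := {ffun S -> R^o}.
Definition dualV := 'Hom(rootV, R^o).

Definition simple_root (s : S) : rootV := [ffun t => (t == s)%:R].

Definition refl_fun (s : S) (x : rootV) : rootV :=
  x - (\sum_t x t * A s t) *: simple_root s.

Fact refl_fun_linear s : linear (refl_fun s).
Proof.
move=> a x y; rewrite /refl_fun scalerBr scalerA addrACA -opprD -scalerDl.
congr (_ - _ *: _); rewrite mulr_sumr -big_split; apply: eq_bigr => t _.
by rewrite !ffunE mulrDl mulrA.
Qed.

HB.instance Definition _ s :=
  GRing.isLinear.Build R rootV rootV *:%R (refl_fun s) (refl_fun_linear s).

Definition refl (s : S) : 'End(rootV) := linfun (refl_fun s).

Lemma refl_simple_root s t :
  refl s (simple_root t) = simple_root t - A s t *: simple_root s.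
Proof.
rewrite lfunE /= /refl_fun (bigD1 t) //= big1 => [|x xt].
  by rewrite ffunE eqxx mul1r addr0.
by rewrite ffunE (negPf xt) mul0r.
Qed.

Definition word_act (u : seq S) : 'End(rootV) :=
  foldr (fun s f => (refl s \o f)%VF) \1%VF u.

(* The action of w is computed on any reduced word of w; as the reflections
   satisfy the Coxeter relations, word_act u only depends on word_prod u. *)
Definition act (w : W) : 'End(rootV) :=
  word_act (xget [::] [set u | reduced_word_of w u]).

Definition dual_act (w : W) (x : dualV) : dualV := (x \o act w^-1%g)%VF.

Definition dominant : set dualV :=
  [set x | forall s, 0 <= x (simple_root s)].

Definition Cvec_word (q : seq S) (u : W) (r : S) : rootV :=
  let P := sorting_positions q r u in
  let j := first_skip q r P in
  act (wp [seq letter q r i | i <- P & (i < j)%N]) (simple_root r).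

Definition Cvec (v : W) (r : S) : option rootV :=
  let K := (r |: Jmax v)%SET in
  if acyclic K then Some (Cvec_word (cword K) v r) else None.

Definition Cone (v : W) : set dualV :=
  [set x | forall r beta, Cvec v r = Some beta -> 0 <= x beta].

End Representation.

End Coxeter.

(* Main.v *)
From HB Require Import structures.
Require Import Defs.
From mathcomp Require Import all_boot all_order all_algebra.
From mathcomp Require Import all_classical all_reals.
From mathcomp Require Import trigo lra ring zify.

(**
Rescaling the simple roots makes the Cartan matrix symmetric, and wD lies in a
half-space given by a root b exactly when w^-1 b is a positive root. So the claim is
that pi_down w = v iff w^-1 C^r(v) > 0 whenever C^r(v) is defined. Both sides are
compared block by block, a block being one step x |-> c(J(x))^-1 x.

Let gamma_r (r in K, K acyclic) be the roots s_1 ... s_(i-1) alpha_(s_i) of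
c(K) = s_1 ... s_n. Then w >= c(K) iff all w^-1 gamma_r < 0. The Euler form E, the
triangular half of the invariant form selected by the orientation, satisfies
E(gamma_r, y) = y_r and E(c y, z) = - E(z, y) on the span of K. If h_r is the root of
the last occurrence of r in the sorting word of v and J = J(v), induction over the
blocks gives z = - sum_r E(z, h_r) C^r(v) on the span of J. In particular
- gamma_j = sum_r (h_r)_j C^r(v) with nonnegative coefficients. Hence w^-1 C^r(v) > 0
for all r in J forces w >= c(J). The remaining conditions, for r outside J, say
exactly that J cannot be enlarged, so that J(w) = J.

That J(w) is the largest, not just a maximal, set is proved by induction on the length
of w. Multiplying by a minimal letter p of J' keeps w >= c(J) unless p is minimal in J
as well, and adding p to J cannot create a directed cycle, since a cycle yields two
inversions of w spanning an infinite dihedral root system.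
*)

Set Implicit Arguments.
Unset Strict Implicit.
Unset Printing Implicit Defensive.
Import Order.TTheory GRing.Theory Num.Theory.

(** * Length *)

Section Length.
Variables (W : groupType) (S : finType) (C : coxeterSystem W S).
Local Notation wp := (word_prod (gen C)).
Local Notation g := (gen C).
Local Notation len := (length C).
Local Open Scope group_scope.

Lemma gen_sq s : g s * g s = 1.
Proof.
have /eqP m1 : cox_m C s s == 1%N by rewrite cox_m_eq1.
by have /cox_m_order := dvdnn (cox_m C s s); rewrite m1 expg1.
Qed.

Lemma genV s : (g s)^-1 = g s.
Proof. by apply: (mulgI (g s)); rewrite mulgV gen_sq. Qed.

Lemma genK s x : g s * (g s * x) = x.
Proof. by rewrite mulgA gen_sq mul1g. Qed.

Lemma wp_nil : wp [::] = 1.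
Proof. by rewrite /word_prod big_nil. Qed.

Lemma wp_cons s u : wp (s :: u) = g s * wp u.
Proof. by rewrite /word_prod big_cons. Qed.

Lemma wp_cat u v : wp (u ++ v) = wp u * wp v.
Proof. by rewrite /word_prod big_cat. Qed.

Lemma wp_rcons u s : wp (rcons u s) = wp u * g s.
Proof. by rewrite -cats1 wp_cat wp_cons wp_nil mulg1. Qed.

Lemma wp_rev u : wp (rev u) = (wp u)^-1.
Proof.
elim: u => [|s u IH]; first by rewrite wp_nil invg1.
by rewrite rev_cons wp_rcons IH wp_cons invgM genV.
Qed.

Lemma len_word u : (len (wp u) <= size u)%N.
Proof.
rewrite /length; case: ex_minnP => m _; apply.
by apply/existsP; exists (in_tuple u).
Qed.

Lemma reduced_exists w : exists u, wp u = w /\ size u = len w.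
Proof.
rewrite /length; case: ex_minnP => m /existsP[u /eqP uw] _.
by exists u; rewrite size_tuple.
Qed.

Lemma len1 : len 1 = 0%N.
Proof. by have := len_word [::]; rewrite wp_nil leqn0 => /eqP. Qed.

Lemma len_eq0 w : len w = 0%N -> w = 1.
Proof.
by have [u [<- <-]] := reduced_exists w => /size0nil ->; rewrite wp_nil.
Qed.

Lemma lenM x y : (len (x * y) <= len x + len y)%N.
Proof.
have [u [<- <-]] := reduced_exists x; have [v [<- <-]] := reduced_exists y.
by rewrite -wp_cat -size_cat len_word.
Qed.

Lemma lenV_le x : (len x^-1 <= len x)%N.
Proof.
by have [u [<- <-]] := reduced_exists x; rewrite -wp_rev -size_rev len_word.
Qed.

Lemma lenV x : len x^-1 = len x.
Proof. by apply/eqP; rewrite eqn_leq lenV_le -{1}(invgK x) lenV_le. Qed.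

Lemma odd_coxeter_equiv (u v : seq S) :
  coxeter_equiv (cox_m C) u v -> odd (size u) = odd (size v).
Proof.
elim=> {u v} [s t|//|u v _ -> //|u v x _ -> _ -> //|u u' v v' _ Hu _ Hv].
  by elim: (cox_m C s t) => //= n; rewrite negbK.
by rewrite !size_cat !oddD Hu Hv.
Qed.

Lemma odd_len u : odd (len (wp u)) = odd (size u).
Proof.
have [v [vu <-]] := reduced_exists (wp u).
by apply: odd_coxeter_equiv; apply/cox_presentation.
Qed.

Definition desc s w := (len (g s * w) < len w)%N.

Lemma desc_len s w : desc s w -> len w = (len (g s * w)).+1.
Proof.
rewrite /desc => H; apply/eqP; rewrite eqn_leq H andbT.
have := lenM (g s) (g s * w); rewrite genK => /leq_trans; apply.
by have := len_word [:: s]; rewrite wp_cons wp_nil mulg1 /=; lia.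
Qed.

Lemma ndesc_len s w : ~~ desc s w -> len (g s * w) = (len w).+1.
Proof.
rewrite /desc -leqNgt => H.
have ub : (len (g s * w) <= (len w).+1)%N.
  apply: leq_trans (lenM _ _) _.
  by have := len_word [:: s]; rewrite wp_cons wp_nil mulg1 /=; lia.
have [u uw] := cox_generated C w.
have := odd_len (s :: u); rewrite wp_cons uw /= -odd_len uw => Ho.
case: (ltngtP (len (g s * w)) (len w).+1) ub => // lt1 _.
by have E : len (g s * w) = len w; [lia | move: Ho; rewrite E; case: odd].
Qed.

Lemma descN s w : desc s (g s * w) = ~~ desc s w.
Proof.
apply/idP/idP => H.
  apply/negP => H'; have := desc_len H; have := desc_len H'; rewrite genK; lia.
have := ndesc_len H; rewrite /desc genK; lia.
Qed.

Lemma desc_word s u : size (s :: u) = len (wp (s :: u)) -> desc s (wp (s :: u)).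
Proof.
by move=> H; rewrite /desc -H wp_cons genK /= ltnS len_word.
Qed.

Lemma exists_desc w : w != 1 -> exists s, desc s w.
Proof.
have [[|s u] [<- Hu]] := reduced_exists w; first by rewrite wp_nil eqxx.
by move=> _; exists s; apply: desc_word.
Qed.

Lemma length_ind (P : W -> Prop) : P 1 ->
  (forall s w, desc s w -> P (g s * w) -> P w) -> forall w, P w.
Proof.
move=> P1 PS w; elim: {w}_.+1 {-2}w (ltnSn (len w)) => // n IH w Hw.
have [->//|/exists_desc[s Hs]] := eqVneq w 1.
by apply: (PS s) => //; apply: IH; rewrite (desc_len Hs) in Hw; lia.
Qed.

End Length.

(** * Bilinear forms and words of reflections *)

Section Forms.
Variables (R : realType) (S : finType).
Local Notation V := (rootV S R).
Local Notation e := (simple_root R).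
Local Open Scope ring_scope.

Definition bil (M : S -> S -> R) (x y : V) : R :=
  \sum_s \sum_t x s * M s t * y t.

Lemma bil_linl M y : linear_for *%R (fun x => bil M x y).
Proof.
move=> a x x'; rewrite /bil mulr_sumr -big_split; apply: eq_bigr => s _ /=.
rewrite mulr_sumr -big_split; apply: eq_bigr => t _ /=.
by rewrite !ffunE !mulrDl !mulrA.
Qed.

Lemma bil_linr M x : linear_for *%R (bil M x).
Proof.
move=> a y y'; rewrite /bil mulr_sumr -big_split; apply: eq_bigr => s _ /=.
rewrite mulr_sumr -big_split; apply: eq_bigr => t _ /=.
by rewrite !ffunE mulrDr; congr (_ + _); rewrite mulrCA.
Qed.

HB.instance Definition _ M x :=
  GRing.isLinear.Build R V R *%R (bil M x) (bil_linr M x).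

Lemma bilDl M x x' y : bil M (x + x') y = bil M x y + bil M x' y.
Proof. by rewrite -[x in LHS]scale1r bil_linl mul1r. Qed.

Lemma bil0l M y : bil M 0 y = 0.
Proof. by apply: (addrI (bil M 0 y)); rewrite -bilDl !addr0. Qed.

Lemma bilZl M a x y : bil M (a *: x) y = a * bil M x y.
Proof. by rewrite -[a *: x]addr0 bil_linl bil0l addr0. Qed.

Lemma bilNl M x y : bil M (- x) y = - bil M x y.
Proof. by rewrite -scaleN1r bilZl mulN1r. Qed.

Lemma bilBl M x x' y : bil M (x - x') y = bil M x y - bil M x' y.
Proof. by rewrite bilDl bilNl. Qed.

Lemma bil_suml M I (r : seq I) P (F : I -> V) y :
  bil M (\sum_(i <- r | P i) F i) y = \sum_(i <- r | P i) bil M (F i) y.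
Proof.
by apply: (big_morph (fun x => bil M x y)) => [x x'|]; rewrite ?bilDl ?bil0l.
Qed.

Lemma bil_el M s y : bil M (e s) y = \sum_t M s t * y t.
Proof.
rewrite /bil (bigD1 s) //= [X in _ + X]big1 ?addr0 => [|u /negPf us].
  by apply: eq_bigr => t _; rewrite ffunE eqxx mul1r.
by apply: big1 => t _; rewrite ffunE us !mul0r.
Qed.

Lemma bil_ee M s t : bil M (e s) (e t) = M s t.
Proof.
rewrite bil_el (bigD1 t) //= big1 ?addr0 => [|u /negPf us].
  by rewrite ffunE eqxx mulr1.
by rewrite ffunE us mulr0.
Qed.

Lemma rootV_sum (x : V) : x = \sum_s x s *: e s.
Proof.
apply/ffunP => t; rewrite sum_ffunE (bigD1 t) //= big1 => [|u /negPf ut].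
  by rewrite !ffunE eqxx addr0 /GRing.scale /= mulr1.
by rewrite !ffunE eq_sym ut scaler0.
Qed.

Lemma refl_formE M s x : refl M s x = x - bil M (e s) x *: e s.
Proof.
rewrite lfunE /= /refl_fun bil_el; congr (_ - _ *: _).
by apply: eq_bigr => t _; rewrite mulrC.
Qed.

Lemma word_act_cons (M : S -> S -> R) s u (x : V) :
  word_act M (s :: u) x = refl M s (word_act M u x).
Proof. by rewrite /= comp_lfunE. Qed.

Lemma word_act_nil (M : S -> S -> R) (x : V) : word_act M [::] x = x.
Proof. by rewrite id_lfunE. Qed.

Lemma word_act_cat (M : S -> S -> R) u v (x : V) :
  word_act M (u ++ v) x = word_act M u (word_act M v x).
Proof.
elim: u => [|s u IH]; first by rewrite word_act_nil.
by rewrite cat_cons !word_act_cons IH.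
Qed.

Lemma word_act_rcons (M : S -> S -> R) u s (x : V) :
  word_act M (rcons u s) x = word_act M u (refl M s x).
Proof. by rewrite -cats1 word_act_cat word_act_cons word_act_nil. Qed.

Definition pos (x : V) : bool := [forall s, 0 <= x s].

Lemma posP (x : V) : reflect (forall s, 0 <= x s) (pos x).
Proof. exact: forallP. Qed.

Lemma posD x y : pos x -> pos y -> pos (x + y).
Proof.
by move=> /posP hx /posP hy; apply/posP => s; rewrite ffunE addr_ge0.
Qed.

Lemma posZ a x : 0 <= a -> pos x -> pos (a *: x).
Proof.
by move=> ha /posP hx; apply/posP => s; rewrite ffunE mulr_ge0 ?hx.
Qed.

Lemma pos_e s : pos (e s).
Proof. by apply/posP => t; rewrite ffunE ler0n. Qed.

Lemma pos0 : pos 0.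
Proof. by apply/posP => t; rewrite ffunE. Qed.

Lemma pos_sum I (r : seq I) (P : pred I) (F : I -> V) :
  (forall i, P i -> pos (F i)) -> pos (\sum_(i <- r | P i) F i).
Proof. by move=> H; apply: (big_ind pos) => //; [exact: pos0 | exact: posD]. Qed.

Lemma pos_anti x : pos x -> pos (- x) -> x = 0.
Proof.
move=> /posP hx /posP hnx; apply/ffunP => s; apply/eqP.
by rewrite ffunE eq_le hx -oppr_ge0; have := hnx s; rewrite ffunE => ->.
Qed.

End Forms.

Section Cheb.
Variable R : realType.
Local Open Scope ring_scope.

(* The Chebyshev polynomials of the second kind, U_k (2 cos x) = sin (k x) / sin x. *)
Fixpoint cheb (b : R) (k : nat) : R :=
  if k is k'.+1 then
    if k' is k''.+1 then b * cheb b k' - cheb b k'' else 1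
  else 0.

Lemma chebSS b k : cheb b k.+2 = b * cheb b k.+1 - cheb b k.
Proof. by []. Qed.

Lemma cheb_sin x k : cheb (2 * cos x) k * sin x = sin (k%:R * x).
Proof.
suff [] : cheb (2 * cos x) k * sin x = sin (k%:R * x) /\
     cheb (2 * cos x) k.+1 * sin x = sin (k.+1%:R * x) by [].
elim: k => [|k [IH1 IH2]]; first by rewrite !mul0r mul1r sin0 mul1r.
split=> //; rewrite chebSS mulrBl -(mulrA (2 * cos x)) IH2 IH1.
have -> : k.+2%:R * x = k.+1%:R * x + x by rewrite -[k.+2]addn1 natrD; ring.
have -> : k%:R * x = k.+1%:R * x - x by rewrite -[k.+1]addn1 natrD; ring.
by rewrite sinB sinD; ring.
Qed.

Lemma cheb_ge b k : 2 <= b -> 0 <= cheb b k /\ cheb b k <= cheb b k.+1.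
Proof.
move=> hb; elim: k => [|k [IH1 IH2]]; first by rewrite /= ler01.
by split; [exact: le_trans IH1 IH2 | rewrite chebSS; nra].
Qed.

Arguments cheb : simpl never.

Variables (m : nat) (m2 : (2 <= m)%N).
Local Notation th := (pi / m%:R : R).

Let m_gt0 : 0 < m%:R :> R. Proof. by rewrite ltr0n; lia. Qed.

Lemma angle_bounds : 0 < th /\ th <= pi / 2.
Proof.
split; first by rewrite divr_gt0 ?pi_gt0.
by rewrite ler_wpM2l ?pi_ge0 // lef_pV2 ?posrE // ler_nat.
Qed.

Lemma sin_angle_gt0 : 0 < sin th.
Proof.
have [h1 h2] := angle_bounds; apply: sin_gt0_pi; rewrite h1 /=.
by apply: le_lt_trans h2 _; have := pi_gt0 R; lra.
Qed.

Lemma cos_angle_ge0 : 0 <= cos th.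
Proof.
have [h1 h2] := angle_bounds; apply: cos_ge0_pihalf; rewrite h2 andbT.
by have := pi_gt0 R; lra.
Qed.

Lemma cheb_angle_ge0 k : (k <= m)%N -> 0 <= cheb (2 * cos th) k.
Proof.
move=> km; rewrite -(pmulr_lge0 _ sin_angle_gt0) cheb_sin; apply: sin_ge0_pi.
have [h1 _] := angle_bounds; rewrite mulr_ge0 ?ler0n ?(ltW h1) //=.
by rewrite mulrA ler_pdivrMr // mulrC ler_wpM2l ?pi_ge0 // ler_nat.
Qed.

Lemma cheb_angle2 : cheb (2 * cos th) m.*2 = 0 /\ cheb (2 * cos th) m.*2.+1 = 1.
Proof.
have sn0 : sin th != 0 by rewrite gt_eqF ?sin_angle_gt0.
have mth : m%:R * th = pi by rewrite mulrCA divff ?mulr1 // gt_eqF.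
have m2th : m.*2%:R * th = pi *+ 2.
  by rewrite -muln2 natrM mulrAC mth mulr_natr.
split; apply: (mulIf sn0); rewrite cheb_sin.
  by rewrite m2th sin2pi mul0r.
by rewrite -[m.*2.+1]addn1 natrD mulrDl m2th mul1r addrC sinD2pi mul1r.
Qed.

Lemma cos_angle_half : (3 <= m)%N -> 1 <= 2 * cos th.
Proof.
move=> m3; have pi0 := pi_gt0 R.
have c3 : cos (pi / 3 : R) = 1 / 2.
  have c0 : 0 < cos (pi / 3 : R) by apply: cos_gt0_pihalf; lra.
  have h : cos ((pi / 3) *+ 2 + pi / 3 : R) = -1.
    by rewrite -(cospi R); congr cos; rewrite mulr2n; lra.
  rewrite cosD cos_mulr2n sin_mulr2n mulrnAl -mulrA -expr2 sin2cos2 in h.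
  have : (cos (pi / 3 : R) + 1) * (2 * cos (pi / 3) - 1) ^+ 2 = 0.
    by rewrite -[RHS](subrr (-1)) -[X in _ = X - _]h !mulr2n; ring.
  by move/eqP; rewrite mulf_eq0 sqrf_eq0 => /orP[] /eqP; lra.
have le3 : th <= pi / 3 by rewrite ler_wpM2l ?pi_ge0 // lef_pV2 ?posrE // ler_nat.
have [h1 h2] := angle_bounds.
have : cos (pi / 3) <= cos th.
  case: (ltgtP th (pi / 3)) le3 => // [lt3 _|-> _] //; apply: ltW.
  by rewrite ltr_cos // in_itv /=; lra.
by rewrite c3; lra.
Qed.

End Cheb.
Arguments cheb : simpl never.

(** * The reflection representation *)

Record symCartan (R : realType) (W : groupType) (S : finType)
    (C : coxeterSystem W S) := SymCartan {
  sym_mx :> S -> S -> R;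
  sym_mxP : symmetrizable_cartan C sym_mx;
  sym_mxC : forall s t, sym_mx s t = sym_mx t s
}.

Section Rep.
Variables (R : realType) (W : groupType) (S : finType) (C : coxeterSystem W S).
Variable B : symCartan R C.
Let hB := sym_mxP B.
Let symB := sym_mxC B.
Local Notation V := (rootV S R).
Local Notation e := (simple_root R).
Local Notation wp := (word_prod (gen C)).
Local Notation g := (gen C).
Local Notation m := (cox_m C).
Local Notation Bf := (bil B).
Local Open Scope ring_scope.

Lemma B_diag s : B s s = 2. Proof. exact: cartan_diag hB s. Qed.

Lemma B_le0 s t : s != t -> B s t <= 0.
Proof. exact: cartan_offdiag hB s t. Qed.

Lemma cox_m_ge2 s t : s != t -> m s t != 0%N -> (2 <= m s t)%N.
Proof. by rewrite -(cox_m_eq1 C) => m1 m0; lia. Qed.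

Lemma B_finite s t : s != t -> m s t != 0%N ->
  B s t = - (2 * cos (pi / (m s t)%:R)).
Proof.
move=> st m0; have := cartan_finite hB st m0; rewrite (symB t s).
have := B_le0 st; have := cos_angle_ge0 R (cox_m_ge2 st m0).
by move=> h1 h2 h3; nra.
Qed.

Lemma B_infinite s t : s != t -> m s t = 0%N -> B s t <= -2.
Proof.
move=> st m0; have := cartan_infinite hB st m0; rewrite (symB t s).
by have := B_le0 st; nra.
Qed.

Lemma B_diagram s t : diagram C s t -> B s t <= -1.
Proof.
move=> /andP[st nc]; have [m0|m0] := eqVneq (m s t) 0%N.
  by have := B_infinite st m0; lra.
rewrite (B_finite st m0) lerN2 cos_angle_half // ?cox_m_ge2 //.
rewrite ltn_neqAle cox_m_ge2 // andbT; apply: contraNneq nc => m2.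
have /cox_m_order := dvdnn (m s t); rewrite -m2 expg2 => h.
rewrite -{2}(genV C s) -{2}(genV C t) -invgM.
by apply/eqP/(mulgI (g s * g t)%g); rewrite h mulgV.
Qed.

Lemma B_nondiagram s t : s != t -> ~~ diagram C s t -> B s t = 0.
Proof.
move=> st; rewrite /diagram st /= negbK => /eqP c.
have /cox_m_order : ((g s * g t) ^+ 2 = 1)%g.
  by rewrite expg2 {2}c -mulgA genK gen_sq.
move=> m2; have m0 : m s t != 0%N by apply: contraTneq m2 => ->.
have -> : B s t = - (2 * cos (pi / 2)).
  rewrite (B_finite st m0); congr (- (2 * cos (pi / _%:R))); apply/eqP.
  by rewrite eqn_leq cox_m_ge2 // dvdn_leq.
by rewrite cos_pihalf mulr0 oppr0.
Qed.

Lemma BfC x y : Bf x y = Bf y x.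
Proof.
rewrite /bil exchange_big; apply: eq_bigr => s _; apply: eq_bigr => t _.
by rewrite symB; ring.
Qed.

Lemma sym_reflE s x : refl B s x = x - Bf (e s) x *: e s.
Proof. exact: refl_formE. Qed.

Lemma refl_e s : refl B s (e s) = - e s.
Proof.
rewrite sym_reflE bil_ee B_diag (_ : 2 = 1 + 1) // scalerDl scale1r opprD addrA.
by rewrite subrr add0r.
Qed.

Lemma reflK s x : refl B s (refl B s x) = x.
Proof.
by rewrite (sym_reflE s x) linearB linearZ /= refl_e sym_reflE scalerN opprK subrK.
Qed.

Lemma refl_isom s x y : Bf (refl B s x) (refl B s y) = Bf x y.
Proof.
rewrite !sym_reflE !(bilBl, linearB, bilZl, linearZ) /= bil_ee B_diag (BfC x (e s)).
by ring.
Qed.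

Lemma word_act_isom u x y : Bf (word_act B u x) (word_act B u y) = Bf x y.
Proof.
elim: u => [|s u IH]; first by rewrite !word_act_nil.
by rewrite !word_act_cons refl_isom.
Qed.

Fixpoint alt (s t : S) k : seq S := if k is k'.+1 then s :: alt t s k' else [::].

Lemma size_alt s t k : size (alt s t k) = k.
Proof. by elim: k s t => //= k IH s t; rewrite IH. Qed.

Lemma altSr s t k : alt s t k.+1 = rcons (alt s t k) (if odd k then t else s).
Proof.
by elim: k s t => [|k IH] s t //; rewrite [alt s t k.+2]/= -/(alt _ _ k.+1) IH /=;
  case: odd.
Qed.

Lemma alt_act s t k (b := - B s t) : s != t ->
  word_act B (rev (alt t s k)) (e s) =
    if odd k then cheb b k *: e s + cheb b k.+1 *: e t
    else cheb b k.+1 *: e s + cheb b k *: e t.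
Proof.
move=> st; elim: k => [|k IH].
  by rewrite word_act_nil /= -[cheb b 1]/1 -[cheb b 0]/0 scale1r scale0r addr0.
rewrite altSr rev_rcons word_act_cons IH.
have ebs : refl B t (e s) = e s + b *: e t by rewrite sym_reflE bil_ee symB scaleNr.
have ebt : refl B s (e t) = e t + b *: e s by rewrite sym_reflE bil_ee scaleNr.
case: ifP => ok; rewrite /= ok linearD !linearZ /= ?ebs ?ebt refl_e chebSS.
  rewrite scalerDr scalerN scalerA scalerBl (mulrC b) addrAC addrA addrAC.
  by rewrite [RHS]addrC addrA addrAC [- _ + _]addrC.
by rewrite scalerDr scalerN scalerA scalerBl (mulrC b) addrA.
Qed.

Lemma flatten_alt s t k : flatten (nseq k [:: s; t]) = alt s t k.*2.
Proof. by elim: k => // k IH; rewrite /= IH. Qed.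

Lemma rev_alt_double s t k : rev (alt s t k.*2) = alt t s k.*2.
Proof.
elim: k => // k IH; rewrite doubleS [alt s t _]/= !rev_cons IH -!cats1 -catA /=.
by rewrite -!flatten_alt; elim: k {IH} => //= k ->.
Qed.

Lemma alt_add s t j k : alt s t (j + k) =
  alt s t j ++ alt (if odd j then t else s) (if odd j then s else t) k.
Proof.
by elim: j s t => // j IH s t; rewrite addSn /= IH; case: odd.
Qed.

Lemma dihedral_act_plane s t : s != t -> m s t != 0%N ->
  word_act B (flatten (nseq (m s t) [:: s; t])) (e s) = e s.
Proof.
move=> st m0; have [c1 c2] := cheb_angle2 R (cox_m_ge2 st m0).
rewrite flatten_alt -rev_alt_double alt_act // odd_double (B_finite st m0) opprK c1 c2.
by rewrite scale1r scale0r addr0.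
Qed.

Lemma word_act_revK u x : word_act B u (word_act B (rev u) x) = x.
Proof.
elim: u x => [|s u IH] x; first by rewrite !word_act_nil.
by rewrite rev_cons word_act_rcons word_act_cons IH reflK.
Qed.

Lemma cox_m_sym s t : m s t = m t s.
Proof.
apply/eqP; rewrite eqn_dvd; apply/andP; split; apply/cox_m_order.
  have /cox_m_order h := dvdnn (m t s).
  by apply: invg_inj; rewrite -expVgn invgM !genV h invg1.
have /cox_m_order h := dvdnn (m s t).
by apply: invg_inj; rewrite -expVgn invgM !genV h invg1.
Qed.

Lemma dihedral_act s t x :
  word_act B (flatten (nseq (m s t) [:: s; t])) x = x.
Proof.
have [<-|st] := eqVneq s t.
  have /eqP -> : m s s == 1%N by rewrite cox_m_eq1.
  by rewrite [flatten _]/= !word_act_cons word_act_nil reflK.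
have [m0|m0] := eqVneq (m s t) 0%N; first by rewrite m0 word_act_nil.
set d := flatten _.
have ds : word_act B d (e s) = e s by apply: dihedral_act_plane.
have dt : word_act B d (e t) = e t.
  suff h : word_act B (rev d) (e t) = e t by rewrite -{1}h word_act_revK.
  rewrite /d flatten_alt rev_alt_double -flatten_alt cox_m_sym.
  by rewrite dihedral_act_plane // ?(eq_sym t) // cox_m_sym.
have [b0 b4] : B s t <= 0 /\ 4 - B s t ^+ 2 > 0.
  split; first exact: B_le0.
  rewrite (B_finite st m0) sqrrN exprMn cos2sin2.
  have := sin_angle_gt0 R (cox_m_ge2 st m0); set z := sin _ => z0.
  by have := mulr_gt0 z0 z0; rewrite -expr2; lra.
pose l := (2 * Bf (e s) x - B s t * Bf (e t) x) / (4 - B s t ^+ 2).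
pose l' := (2 * Bf (e t) x - B s t * Bf (e s) x) / (4 - B s t ^+ 2).
pose y := x - (l *: e s + l' *: e t).
have ys : Bf (e s) y = 0.
  rewrite /y linearB linearD !linearZ /= !bil_ee B_diag /l /l'.
  by field; rewrite gt_eqF.
have yt : Bf (e t) y = 0.
  rewrite /y linearB linearD !linearZ /= !bil_ee B_diag (symB t s) /l /l'.
  by field; rewrite gt_eqF.
have dy : word_act B d y = y.
  rewrite /d; elim: (m s t) => [|k IH]; first by rewrite word_act_nil.
  by rewrite [flatten _]/= !word_act_cons IH !sym_reflE yt scale0r subr0 ys scale0r subr0.
have xE : x = y + (l *: e s + l' *: e t) by rewrite subrK.
by clearbody y; rewrite [in LHS]xE !linearD !linearZ /= dy ds dt -xE.
Qed.

Lemma word_act_equiv u v : coxeter_equiv m u v ->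
  forall x, word_act B u x = word_act B v x.
Proof.
elim=> {u v} [s t x|//|u v _ IH x|u v w _ IH1 _ IH2 x|u u' v v' _ IH1 _ IH2 x].
- by rewrite dihedral_act word_act_nil.
- by rewrite IH.
- by rewrite IH1.
- by rewrite !word_act_cat IH2 IH1.
Qed.

Local Notation act := (act C B).

Lemma act_wp u x : act (wp u) x = word_act B u x.
Proof.
rewrite /Defs.act; apply: word_act_equiv; apply/cox_presentation.
case: xgetP => [v _ [] // |none].
by have [v vu] := reduced_exists C (wp u); have := none v.
Qed.

Lemma actD w x y : act w (x + y) = act w x + act w y.
Proof. exact: linearD. Qed.

Lemma actN w x : act w (- x) = - act w x.
Proof. exact: linearN. Qed.

Lemma actB w x y : act w (x - y) = act w x - act w y.
Proof. exact: linearB. Qed.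

Lemma actZ w a x : act w (a *: x) = a *: act w x.
Proof. exact: linearZ. Qed.

Lemma act_sum w I (r : seq I) (P : pred I) (F : I -> V) :
  act w (\sum_(i <- r | P i) F i) = \sum_(i <- r | P i) act w (F i).
Proof. exact: linear_sum. Qed.

Lemma act1 x : act 1%g x = x.
Proof. by rewrite -(wp_nil C) act_wp word_act_nil. Qed.

Lemma actM a b x : act (a * b)%g x = act a (act b x).
Proof.
have [u <-] := cox_generated C a; have [v <-] := cox_generated C b.
by rewrite -wp_cat !act_wp word_act_cat.
Qed.

Lemma act_gen s x : act (g s) x = x - Bf (e s) x *: e s.
Proof.
by rewrite -[g s]mulg1 -(wp_nil C) -wp_cons act_wp word_act_cons word_act_nil sym_reflE.
Qed.

Lemma actK a x : act a^-1%g (act a x) = x.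
Proof. by rewrite -actM mulVg act1. Qed.

Lemma actVK a x : act a (act a^-1%g x) = x.
Proof. by rewrite -actM mulgV act1. Qed.

Lemma act_gen_e s : act (g s) (e s) = - e s.
Proof. by rewrite act_gen -sym_reflE refl_e. Qed.

Lemma act_isom w x y : Bf (act w x) (act w y) = Bf x y.
Proof. by have [u <-] := cox_generated C w; rewrite !act_wp word_act_isom. Qed.

Lemma braid s t : wp (alt s t (m s t)) = wp (alt t s (m s t)).
Proof.
set k := m s t.
have h : wp (alt s t k.*2) = 1%g.
  have pw j : wp (flatten (nseq j [:: s; t])) = ((g s * g t) ^+ j)%g.
    elim: j => [|j IH]; first by rewrite wp_nil.
    by rewrite [flatten _]/= !wp_cons IH expgS mulgA.
  by rewrite -flatten_alt pw; apply/cox_m_order.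
have hr := rev_alt_double s t k.
rewrite -addnn !alt_add rev_cat in hr.
have /andP[/eqP h1 _] : (rev (alt (if odd k then t else s) (if odd k then s else t) k)
   == alt t s k) &&
   (rev (alt s t k) == alt (if odd k then s else t) (if odd k then t else s) k).
  by rewrite -eqseq_cat ?size_rev ?size_alt // hr.
move: h; rewrite -addnn alt_add wp_cat => /mulg1_eq h.
by rewrite -h1 wp_rev -h invgK.
Qed.

End Rep.

(** * Positivity of roots *)

Section Roots.
Variables (R : realType) (W : groupType) (S : finType) (C : coxeterSystem W S).
Variable B : symCartan R C.
Local Notation e := (simple_root R).
Local Notation wp := (word_prod (gen C)).
Local Notation g := (gen C).
Local Notation len := (length C).
Local Notation act := (act C B).
Local Notation desc := (desc C).
Local Open Scope ring_scope.

Definition rdesc w s := desc s w^-1%g.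

Lemma rdescE w s : rdesc w s = desc s w^-1%g. Proof. by []. Qed.

Lemma rdesc_len w s : rdesc w s -> len w = (len (w * g s)%g).+1.
Proof. by move/desc_len; rewrite lenV => ->; rewrite -[in RHS]lenV invgM genV. Qed.

Lemma nrdesc_len w s : ~~ rdesc w s -> len (w * g s)%g = (len w).+1.
Proof. by move/ndesc_len; rewrite lenV => <-; rewrite -lenV invgM genV. Qed.

Lemma rdescN w s : rdesc (w * g s)%g s = ~~ rdesc w s.
Proof. by rewrite /rdesc invgM genV descN. Qed.

Lemma alt_decomposition w s t : s != t -> ~~ rdesc w s ->
  exists v k, [/\ w = (v * wp (rev (alt t s k)))%g, (len w = len v + k)%N,
    ~~ rdesc v s, ~~ rdesc v t & rdesc w t -> (0 < k)%N].
Proof.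
elim: {w}_.+1 {-2}w (ltnSn (len w)) s t => // n IH w Hw s t st ws.
have [wt|wt] := boolP (rdesc w t); last first.
  by exists w, 0%N; rewrite wp_nil mulg1 addn0.
have lw := rdesc_len wt.
have ts : t != s by rewrite eq_sym.
have Hw' : (len (w * g t)%g < n)%N by lia.
have wt' : ~~ rdesc (w * g t)%g t by rewrite rdescN wt.
have [v [k [E lE h1 h2 _]]] := IH _ Hw' t s ts wt'.
exists v, k.+1; split=> //; last by rewrite lw lE addnS.
by rewrite /= rev_cons wp_rcons mulgA -E -mulgA gen_sq mulg1.
Qed.

Lemma act_simple_pos w s : ~~ rdesc w s -> pos (act w (e s)).
Proof.
elim: {w}_.+1 {-2}w (ltnSn (len w)) s => // n IH w Hw s ws.
have [-> |w1] := eqVneq w 1%g; first by rewrite act1 pos_e.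
have [|t wt] := @exists_desc _ _ C w^-1%g; first by rewrite invg_eq1.
have st : s != t by apply: contraNneq ws => ->.
have [v [k [E lE vs vt /(_ wt) k0]]] := alt_decomposition st ws.
have ps : pos (act v (e s)) by apply: IH => //; lia.
have pt : pos (act v (e t)) by apply: IH => //; lia.
have km : cox_m C s t != 0%N -> (k < cox_m C s t)%N.
  move=> m0; rewrite ltnNge; apply: contraNN ws => mk.
  have [j kE] : exists j, k = (j + cox_m C s t)%N by exists (k - cox_m C s t)%N; lia.
  have [m' mE] : exists m', cox_m C s t = m'.+1 by exists (cox_m C s t).-1; lia.
  have [x [y xy]] : exists x y, alt t s k = alt t s (cox_m C s t) ++ alt x y j.
    by rewrite kE addnC alt_add; do 2!eexists.
  have h : (w * g s = v * wp (rev (alt x y j) ++ rev (alt t s m')))%g.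
    rewrite E xy rev_cat !wp_cat (wp_rev _ (alt t s _)) -braid mE /= wp_cons.
    by rewrite invgM genV -wp_rev -!mulgA gen_sq mulg1.
  apply: contraT => /nrdesc_len; rewrite h lE kE mE => h'.
  have := lenM C v (wp (rev (alt x y j) ++ rev (alt t s m'))).
  have := len_word C (rev (alt x y j) ++ rev (alt t s m')).
  by rewrite size_cat !size_rev !size_alt h'; lia.
have c01 : 0 <= cheb (- B s t) k /\ 0 <= cheb (- B s t) k.+1.
  have [m0|m0] := eqVneq (cox_m C s t) 0%N.
    have hb : 2 <= - B s t by have := B_infinite B st m0; lra.
    by have [h1 h2] := cheb_ge k hb; split=> //; apply: le_trans h2.
  rewrite (B_finite B st m0) opprK; split; apply: cheb_angle_ge0; rewrite ?cox_m_ge2 //.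
    exact: ltnW (km m0).
  exact: km m0.
rewrite E actM (act_wp B) alt_act //.
by case: ifP => _; rewrite actD !actZ; apply: posD; apply: posZ; case: c01.
Qed.

End Roots.

Section Roots.
Variables (R : realType) (W : groupType) (S : finType) (C : coxeterSystem W S).
Variable B : symCartan R C.
Local Notation V := (rootV S R).
Local Notation e := (simple_root R).
Local Notation g := (gen C).
Local Notation len := (length C).
Local Notation Bf := (bil B).
Local Notation act := (act C B).
Local Notation desc := (desc C).
Local Notation rdesc := (rdesc C).
Local Open Scope ring_scope.
Implicit Types (J K : {set S}) (s r : S).

Definition is_root (x : V) : Prop := exists w s, x = act w (e s).

Lemma root_act w x : is_root x -> is_root (act w x).
Proof. by move=> [a [s ->]]; exists (w * a)%g, s; rewrite actM. Qed.

Lemma root_e s : is_root (e s).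
Proof. by exists 1%g, s; rewrite act1. Qed.

Lemma root_opp x : is_root x -> is_root (- x).
Proof.
by move=> [a [s ->]]; exists (a * g s)%g, s; rewrite actM act_gen_e actN.
Qed.

Lemma root_norm x : is_root x -> Bf x x = 2.
Proof. by move=> [a [s ->]]; rewrite act_isom bil_ee B_diag. Qed.

Lemma root_neq0 x : is_root x -> x != 0.
Proof.
by move=> /root_norm h; apply: contraTneq isT => x0; move: h; rewrite x0 linear0; lra.
Qed.

Lemma act_simple_sign w s : pos (act w (e s)) = ~~ rdesc w s.
Proof.
have [ws|ws] := boolP (rdesc w s); last exact: act_simple_pos.
apply/negP => p1; have := @act_simple_pos _ _ _ _ B (w * g s)%g s.
rewrite rdescN ws actM act_gen_e actN => /(_ isT) p2.
have /root_neq0/eqP : is_root (act w (e s)) by apply/root_act/root_e.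
by apply; apply: pos_anti.
Qed.

Lemma root_posN x : is_root x -> pos (- x) = ~~ pos x.
Proof.
move=> [w [s ->]]; rewrite act_simple_sign negbK.
by rewrite -actN -(act_gen_e B) -actM act_simple_sign rdescN negbK.
Qed.

Lemma desc_pos s w : desc s w = ~~ pos (act w^-1 (e s)).
Proof. by rewrite act_simple_sign negbK rdescE invgK. Qed.

Lemma root_coord_pos x s : is_root x -> 0 < x s -> pos x.
Proof.
move=> rx xs; apply: contraTT xs; rewrite -root_posN // => /posP/(_ s).
by rewrite ffunE oppr_ge0 -leNgt.
Qed.

Lemma act_faithful a b : (forall x, act a x = act b x) -> a = b.
Proof.
move=> h; apply/divg1_eq; apply: contrapT => /eqP/(@exists_desc _ _ C)[s].
by rewrite desc_pos invgM invgK actM -h -actM mulgV act1 pos_e.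
Qed.

Lemma act_gen_out s x t : t != s -> act (g s) x t = x t.
Proof. by move=> /negPf ts; rewrite act_gen !ffunE ts /= scaler0 subr0. Qed.

Lemma pos_act_gen s x : is_root x -> pos x -> ~~ pos (act (g s) x) -> x = e s.
Proof.
move=> rx px nx.
have x0 t : t != s -> x t = 0.
  move=> ts; apply/eqP; rewrite eq_le (posP _ px) andbT leNgt.
  apply: contra nx => xt; apply: (@root_coord_pos _ t); first exact: root_act.
  by rewrite act_gen_out.
have xE : x = x s *: e s.
  rewrite {1}[x]rootV_sum (bigD1 s) //= big1 ?addr0 // => t ts.
  by rewrite x0 // scale0r.
have := root_norm rx; rewrite xE bilZl linearZ /= bil_ee B_diag => h.
have := posP _ px s; move: h; set c := x s => h c0.
by have -> : c = 1 by [nra]; rewrite scale1r.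
Qed.

Lemma act_reflection x s y :
  act (x * g s * x^-1)%g y = y - Bf (act x (e s)) y *: act x (e s).
Proof.
by rewrite !actM act_gen actB actZ -[in RHS](actVK B x y) act_isom.
Qed.

Lemma reflection_eq x s y t : act x (e s) = act y (e t) ->
  (x * g s * x^-1 = y * g t * y^-1)%g.
Proof. by move=> h; apply: act_faithful => z; rewrite !act_reflection h. Qed.

Lemma reflection_len x s w : pos (act x (e s)) ->
  ~~ pos (act w^-1 (act x (e s))) -> (len (x * g s * x^-1 * w)%g < len w)%N.
Proof.
elim/(@length_ind _ _ C): w x s => [|r w rw IH] x s px.
  by rewrite invg1 act1 px.
move=> nw; have [h|h] := boolP (pos (act (g r) (act x (e s)))); last first.
  have xr : act x (e s) = act 1 (e r).
    by rewrite act1; apply: pos_act_gen => //; apply/root_act/root_e.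
  by rewrite (reflection_eq xr) invg1 mulg1 mul1g.
rewrite -actM in h.
have E1 : ((g r * w)^-1 * (g r * x) = w^-1 * x)%g by rewrite invgM -mulgA mulKg.
have E2 : (g r * x * g s * (g r * x)^-1 * (g r * w) =
    g r * (x * g s * x^-1 * w))%g by rewrite invgM -!mulgA mulKg.
have := IH _ s h; rewrite -actM E1 actM E2 => /(_ nw); rewrite (desc_len rw).
have := lenM C (g r) (g r * (x * g s * x^-1 * w)).
have := len_word C [:: r]; rewrite wp_cons wp_nil mulg1 genK /=; lia.
Qed.

Lemma reflection_lenE x s w : pos (act x (e s)) ->
  (len (x * g s * x^-1 * w)%g < len w)%N = ~~ pos (act w^-1 (act x (e s))).
Proof.
move=> px; have [h|h] := boolP (pos _); last exact: reflection_len.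
apply/negbTE; rewrite -leqNgt; set t := (_ * x^-1)%g.
have tt : (t * t = 1)%g by rewrite /t -!mulgA mulKg (mulgA (g s)) gen_sq mul1g mulgV.
have tV : (t^-1 = t)%g by rewrite /t !invgM invgK genV mulgA.
have := @reflection_len x s (t * w)%g px; rewrite -/t mulgA tt mul1g => lt.
apply/ltnW/lt; rewrite invgM tV actM.
have -> : act t (act x (e s)) = - act x (e s).
  by rewrite /t -!actM -!mulgA mulVg mulg1 actM act_gen_e actN.
by rewrite actN root_posN ?negbK //; do 2!apply: root_act; apply: root_e.
Qed.

Definition supp (J : {set S}) (x : V) := [forall s, (s \notin J) ==> (x s == 0)].

Lemma suppP J (x : V) : reflect (forall s, s \notin J -> x s = 0) (supp J x).
Proof.
apply: (iffP forallP) => h s; last by apply/implyP => /h ->.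
by move=> sJ; have /implyP/(_ sJ)/eqP := h s.
Qed.

Lemma suppD J x y : supp J x -> supp J y -> supp J (x + y).
Proof.
by move=> /suppP hx /suppP hy; apply/suppP => s sJ; rewrite ffunE hx ?hy ?addr0.
Qed.

Lemma suppZ J a x : supp J x -> supp J (a *: x).
Proof. by move=> /suppP hx; apply/suppP => s sJ; rewrite ffunE hx ?scaler0. Qed.

Lemma suppN J x : supp J x -> supp J (- x).
Proof. by rewrite -scaleN1r; apply: suppZ. Qed.

Lemma suppB J x y : supp J x -> supp J y -> supp J (x - y).
Proof. by move=> hx hy; apply: suppD => //; apply: suppN. Qed.

Lemma supp_e (J : {set S}) s : s \in J -> supp J (e s).
Proof.
move=> sJ; apply/suppP => t tJ; rewrite ffunE; case: eqP => // ts.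
by rewrite ts sJ in tJ.
Qed.

Lemma supp_sum (J : {set S}) I (r : seq I) (P : pred I) (F : I -> V) :
  (forall i, P i -> supp J (F i)) -> supp J (\sum_(i <- r | P i) F i).
Proof.
move=> H; apply: (big_ind (supp J)) => //; last by move=> x y; apply: suppD.
by apply/suppP => s _; rewrite ffunE.
Qed.

Lemma suppS (J K : {set S}) x : J \subset K -> supp J x -> supp K x.
Proof.
move=> JK /suppP h; apply/suppP => s sK; apply: h.
by apply: contra sK; apply: (fintype.subsetP JK).
Qed.

Lemma supp_sumE (J : {set S}) x : supp J x -> x = \sum_(s in J) x s *: e s.
Proof.
move=> /suppP h; rewrite {1}[x]rootV_sum (bigID (mem J)) /= [X in _ + X]big1 ?addr0 //.
by move=> s /h ->; rewrite scale0r.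
Qed.

Local Notation par := (parabolic C).

Lemma par1 J : par J 1%g.
Proof. by exists [::]; rewrite wp_nil. Qed.

Lemma par_gen (J : {set S}) s : s \in J -> par J (g s).
Proof.
by move=> sJ; exists [:: s]; rewrite wp_cons wp_nil mulg1; split=> // t /[!inE] /eqP->.
Qed.

Lemma parM J a b : par J a -> par J b -> par J (a * b)%g.
Proof.
move=> [u [uJ <-]] [v [vJ <-]]; exists (u ++ v); rewrite wp_cat; split=> // s.
by rewrite mem_cat => /orP[/uJ|/vJ].
Qed.

Lemma parV J a : par J a -> par J a^-1%g.
Proof.
move=> [u [uJ <-]]; exists (rev u); rewrite wp_rev; split=> // s.
by rewrite mem_rev; apply: uJ.
Qed.

Lemma parS (J K : {set S}) a : J \subset K -> par J a -> par K a.
Proof.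
by move=> JK [u [uJ <-]]; exists u; split=> // s /uJ; apply: (fintype.subsetP JK).
Qed.

Lemma par_act_out (J : {set S}) a x s : par J a -> s \notin J -> act a x s = x s.
Proof.
move=> [u [uJ <-]] sJ; elim: u uJ => [|t u IH] uJ; first by rewrite wp_nil act1.
rewrite wp_cons actM act_gen_out ?IH // => [r ru|].
  by apply: uJ; rewrite inE ru orbT.
by apply: contraNneq sJ => ->; apply: uJ; rewrite inE eqxx.
Qed.

Lemma par_act_supp J a x : par J a -> supp J x -> supp J (act a x).
Proof.
by move=> aJ /suppP h; apply/suppP => s sJ; rewrite (par_act_out _ aJ) ?h.
Qed.

Lemma par_ind J (P : W -> Prop) : P 1%g ->
  (forall s a, s \in J -> par J a -> P a -> P (g s * a)%g) ->
  forall a, par J a -> P a.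
Proof.
move=> P1 PS a [u [uJ <-]]; elim: u uJ => [|s u IH] uJ; first by rewrite wp_nil.
have uJ' : {subset u <= J} by move=> t tu; apply: uJ; rewrite inE tu orbT.
rewrite wp_cons; apply: PS; [by apply: uJ; rewrite inE eqxx| by exists u|exact: IH].
Qed.

Lemma par_pos_out (J : {set S}) a x s :
  par J a -> is_root x -> s \notin J -> 0 < x s -> pos (act a x).
Proof.
move=> aJ rx sJ xs; apply: (@root_coord_pos _ s); first exact: root_act.
by rewrite (par_act_out _ aJ).
Qed.

Lemma par_inversion_supp J a x : par J a -> is_root x -> pos x ->
  ~~ pos (act a^-1 x) -> supp J x.
Proof.
move=> aJ rx /posP px nx; apply/suppP => s sJ; apply/eqP.
rewrite eq_le px andbT leNgt; apply: contra nx.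
by apply: par_pos_out sJ => //; apply: parV.
Qed.

Lemma par_inversion_reflection J a x s : par J a -> pos (act x (e s)) ->
  ~~ pos (act a^-1 (act x (e s))) -> par J (x * g s * x^-1)%g.
Proof.
move=> aJ; elim/par_ind: aJ x => {a} [|r a rJ aJ IH] x px; first by rewrite invg1 act1 px.
move=> nx; have [h|h] := boolP (pos (act (g r) (act x (e s)))); last first.
  have xr : act x (e s) = act 1%g (e r).
    by rewrite act1; apply: pos_act_gen => //; apply/root_act/root_e.
  by rewrite (reflection_eq xr) invg1 mulg1 mul1g; apply: par_gen.
rewrite -actM in h; have := IH _ h.
have E1 : (a^-1 * (g r * x) = (g r * a)^-1 * x)%g by rewrite invgM genV mulgA.
rewrite -actM E1 actM => /(_ nx) hp.
have -> : (x * g s * x^-1 = g r * (g r * x * g s * (g r * x)^-1) * g r)%g.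
  by rewrite invgM genV -!mulgA genK gen_sq mulg1.
by apply: parM; [apply: parM|] => //; apply: par_gen.
Qed.

Lemma par_reflection_supp J x s : par J (x * g s * x^-1)%g -> supp J (act x (e s)).
Proof.
move=> tJ; apply/suppP => t tJ'; have := par_act_out (act x (e s)) tJ tJ'.
rewrite act_reflection act_isom bil_ee B_diag !ffunE /GRing.scale /=; lra.
Qed.

Lemma par_factor J w : exists x, [/\ par J x, (len x <= len w)%N &
  forall s, s \in J -> pos (act (x^-1 * w)^-1 (e s))].
Proof.
elim: {w}_.+1 {-2}w (ltnSn (len w)) => // n IH w Hw.
have [/existsP[s /andP[sJ sw]]|] := boolP [exists s, (s \in J) && desc s w].
  have lw := desc_len sw.
  have [|x [xJ lx h]] := IH (g s * w)%g; first by lia.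
  exists (g s * x)%g; split; first by apply: parM => //; apply: par_gen.
    have := lenM C (g s) x; have := len_word C [:: s].
    by rewrite wp_cons wp_nil mulg1 /=; lia.
  by move=> t /h; rewrite (invgM (g s)) genV mulgA.
rewrite negb_exists => /forallP h; exists 1%g; split; [exact: par1 | by rewrite len1 |].
move=> s sJ; have := h s; rewrite sJ /= desc_pos negbK.
by rewrite invg1 mul1g.
Qed.

Lemma pos_act_supp J y x : (forall s, s \in J -> pos (act y (e s))) ->
  is_root x -> supp J x -> pos (act y x) = pos x.
Proof.
move=> h rx sx; have aux z : supp J z -> pos z -> pos (act y z).
  move=> sz /posP pz; rewrite (supp_sumE sz) act_sum; apply: pos_sum => s sJ.
  by rewrite actZ; apply: posZ => //; apply: h.
apply/idP/idP; last exact: aux.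
apply: contraTT; rewrite -!root_posN //; last exact: root_act.
by rewrite -actN; apply: aux; apply: suppN.
Qed.

Lemma parabolic_partP J w :
  [/\ par J (parabolic_part C J w), (len (parabolic_part C J w) <= len w)%N &
   forall x, is_root x -> supp J x ->
    pos (act (parabolic_part C J w)^-1 x) = pos (act w^-1 x)].
Proof.
have [x [xJ lx h]] := par_factor J w.
have sgn z : is_root z -> supp J z -> pos (act x^-1 z) = pos (act w^-1 z).
  move=> rz sz; have -> : (w^-1 = (x^-1 * w)^-1 * x^-1)%g by rewrite invgM invgK mulgK.
  rewrite actM [RHS](@pos_act_supp J) //; first exact: root_act.
  by apply: par_act_supp => //; apply: parV.
have conjE a s : (g s ^ a = a^-1 * g s * a^-1^-1)%g by rewrite invgK /conjg mulgA.
have rp t : reflection C t -> exists a s, t = (a * g s * a^-1)%g /\ pos (act a (e s)).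
  move=> [a [s ->]]; rewrite conjE.
  have [p|p] := boolP (pos (act a^-1 (e s))); first by exists a^-1%g, s.
  exists (a^-1 * g s)%g, s; split; first by rewrite invgM !mulgA mulgK.
  by rewrite actM act_gen_e actN root_posN //; apply/root_act/root_e.
have invx : inversions C x = (inversions C w `&` par J)%classic.
  apply/seteqP; split => t [].
    move=> /[dup] rt /rp[a [s [-> p]]]; rewrite (reflection_lenE _ p) => n.
    have sJ := par_inversion_supp xJ (root_act a (root_e s)) p n.
    split; last exact: par_inversion_reflection n.
    split; first by exists a^-1%g, s; rewrite conjE invgK.
    by rewrite /= (reflection_lenE _ p) -sgn //; apply/root_act/root_e.
  move=> [] /[dup] rt /rp[a [s [-> p]]]; rewrite (reflection_lenE _ p) => n tJ.
  split; first by exists a^-1%g, s; rewrite conjE invgK.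
  rewrite /= (reflection_lenE _ p) sgn //; first by apply/root_act/root_e.
  exact: par_reflection_supp.
have -> : parabolic_part C J w = x; last by [].
rewrite /parabolic_part; apply: xget_unique => [//|y [yJ invy]].
(* A simple s with s <= x^-1 y gives the inversion x (e s) of exactly one of x and y. *)
apply: contrapT => xy; have /(@exists_desc _ _ C)[s] : (x^-1 * y)%g != 1%g.
  by apply/eqP => /mulg1_eq; rewrite invgK => E; apply: xy.
rewrite desc_pos invgM invgK actM => n.
have E : inversions C x = inversions C y by rewrite invx invy.
have rxs : reflection C (x * g s * x^-1)%g by exists x^-1%g, s; rewrite conjE invgK.
have [p|p] := boolP (pos (act x (e s))).
  have : inversions C y (x * g s * x^-1)%g by split=> //; rewrite /= reflection_lenE.
  by rewrite -E => -[_]; rewrite /= reflection_lenE // actK pos_e.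
have aE : act (x * g s)%g (e s) = - act x (e s) by rewrite actM act_gen_e actN.
have rx z : is_root (act z (e s)) by apply/root_act/root_e.
have pa : pos (act (x * g s)%g (e s)) by rewrite aE root_posN.
have : inversions C x ((x * g s) * g s * (x * g s)^-1)%g.
  split; first by exists (x * g s)^-1%g, s; rewrite conjE invgK.
  by rewrite /= reflection_lenE // aE actN actK root_posN ?pos_e //; apply: root_e.
rewrite E => -[_]; rewrite /= reflection_lenE // aE actN root_posN ?negbK.
  by rewrite (negPf n).
exact/root_act.
Qed.

End Roots.

(** * Acyclic sets *)

Section Acyclic.
Variables (W : groupType) (S : finType) (C : coxeterSystem W S).
Variable Om : orientation C.
Implicit Types (J K : {set S}) (s t r : S) (p q : seq S).

Lemma orient_irr s : Om s s = false.
Proof. by apply/negP => /orient_diagram; rewrite /diagram eqxx. Qed.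

Lemma orient_anti s t : Om s t -> Om t s = false.
Proof. by move=> st; apply/negbTE; rewrite -(orient_one Om (orient_diagram st)). Qed.

Lemma acyclicS J K : J \subset K -> acyclic Om K -> acyclic Om J.
Proof.
move=> /fintype.subsetP JK /asboolP h; apply/asboolP => p p0 pJ; apply: h => // s /pJ.
exact: JK.
Qed.

Lemma acyclic_rank J (f : S -> nat) :
  {in J &, forall s t, Om s t -> (f t < f s)%N} -> acyclic Om J.
Proof.
move=> h; apply/asboolP => -[//|s p] _ pJ; apply/negP => /= sp.
have : path (relpre f gtn) s (rcons p s).
  apply: (@sub_in_path _ (mem J) Om) sp; first by move=> a b aJ bJ; apply: h.
  by apply/allP => a; rewrite inE mem_rcons => /or3P[/eqP->|/eqP->|ap]; apply: pJ;
    rewrite ?mem_head // in_cons; apply/orP; right.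
have tr : transitive (relpre f gtn) by move=> a b c /= ba ac; apply: ltn_trans ac ba.
move/(order_path_min tr).
by rewrite all_rcons /= ltnn.
Qed.

Lemma acyclic_source J : J != finset.set0 -> acyclic Om J ->
  exists2 s, s \in J & {in J, forall t, ~~ Om s t}.
Proof.
move=> J0 /asboolP aJ; apply: contrapT => none.
have next s : exists t, s \in J -> (t \in J) && Om s t.
  have [sJ|sJ] := boolP (s \in J); last by exists s.
  apply: contrapT => nt; apply: none; exists s => // t tJ; apply/negP => st.
  by apply: nt; exists t; rewrite tJ st.
have [f fP] := choice next.
have /set0Pn[x xJ] := J0.
have fJ n : iter n f x \in J.
  by elim: n => //= n /fP/andP[].
have /trajectP[i ilt iE] := looping_order f x.
set n := fingraph.order f x in ilt iE.
pose y := iter i f x; pose k := (n - i)%N.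
have k0 : (0 < k)%N by rewrite subn_gt0.
have yk : iter k f y = y by rewrite /y -iterD subnK // ltnW.
have yJ j : iter j f y \in J by rewrite /y -iterD.
have trJ : {subset traject f y k <= J} by move=> z /trajectP[j _ ->].
have := aJ (traject f y k); rewrite -size_eq0 size_traject -lt0n => /(_ k0 trJ) /negP; apply.
case: k k0 yk trJ => // k _ yk trJ; rewrite trajectS /=.
have -> : rcons (traject f (f y) k) y = traject f (f y) k.+1.
  by rewrite trajectSr -iterSr yk.
have : path (frel f) y (traject f (f y) k.+1) by apply: fpath_traject.
apply: (@sub_in_path _ (mem J)); last first.
  rewrite -trajectS; apply/allP => z /trajectP[j _ ->]; exact: yJ.
by move=> a b aJ' bJ' /= /eqP <-; case/andP: (fP a aJ').
Qed.

Lemma acyclic_rank_exists J : acyclic Om J ->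
  exists f : S -> nat, {in J &, forall s t, Om s t -> (f t < f s)%N}.
Proof.
elim: {J}_.+1 {-2}J (ltnSn #|J|) => // n IH J HJ aJ.
have [->|J0] := eqVneq J finset.set0; first by exists (fun=> 0%N) => s t; rewrite inE.
have [s sJ smin] := acyclic_source J0 aJ.
have [||f fP] := IH (J :\ s)%SET.
- by rewrite (cardsD1 s J) sJ in HJ.
- by apply: acyclicS aJ; apply: subsetDl.
exists (fun t => if t == s then 0 else (f t).+1)%N => a b aJ' bJ' ab.
have as_ : a != s by apply: contraTneq ab => ->; apply: smin.
rewrite (negPf as_); case: eqP => // /eqP bs; rewrite ltnS; apply: fP => //.
  by rewrite !inE as_.
by rewrite !inE bs.
Qed.

Lemma acyclic_setU1_source J s : acyclic Om J -> {in J, forall t, ~~ Om s t} ->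
  acyclic Om (s |: J)%SET.
Proof.
move=> /acyclic_rank_exists[f fP] h.
apply: (@acyclic_rank _ (fun t => if t == s then 0 else (f t).+1)%N) => a b.
rewrite !inE => /predU1P[->|aJ] /predU1P[->|bJ] ab; first by rewrite orient_irr in ab.
- by rewrite (negPf (h b bJ)) in ab.
- have as_ : a != s by apply: contraTneq ab => ->; rewrite orient_irr.
  by rewrite eqxx (negPf as_).
have as_ : a != s by apply: contraTneq ab => ->; apply: h.
by rewrite (negPf as_); case: eqP => // _; rewrite ltnS fP.
Qed.

(* Earlier letters are never the head of an arrow to a later one; up to the
   enumerated set this is [acyclic_order]. *)
Definition topo p := uniq p && pairwise (fun s t => ~~ Om s t) p.

Lemma topo_cons s p : topo (s :: p) =
  [&& s \notin p, all (fun t => ~~ Om s t) p & topo p].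
Proof. by rewrite /topo /=; case: (s \in p) => //=; rewrite andbCA. Qed.

Lemma topo_filter (a : pred S) p : topo p -> topo (seq.filter a p).
Proof.
case/andP => u pw; rewrite /topo filter_uniq //=.
by rewrite (subseq_pairwise (filter_subseq a p)).
Qed.

Lemma topo_acyclic_order J p : acyclic_order Om J p <-> topo p /\ p =i J.
Proof.
split=> [[u pJ h]|[/andP[u pw] pJ]].
  split=> //; rewrite /topo u; case: p u pJ h => // x0 p' u pJ h.
  set p := x0 :: p' in u pJ h *; apply/(pairwiseP x0) => i j; rewrite !inE => ip jp ij.
  apply/negP => /h; rewrite -!pJ !mem_nth // !index_uniq // => /(_ isT isT).
  by rewrite ltnNge ltnW.
split=> // s t sJ tJ st; rewrite ltnNge leq_eqVlt; apply/negP => /orP[/eqP E|lt].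
  have E' : s = t.
    by rewrite -[LHS](nth_index s (s := p)) ?pJ // -[RHS](nth_index s (s := p)) ?pJ // E.
  by rewrite E' orient_irr in st.
have := pairwiseP s pw (index s p) (index t p).
by rewrite !inE !index_mem !pJ !nth_index ?pJ // sJ tJ st => /(_ isT isT lt).
Qed.

Lemma cwordP J : acyclic Om J -> topo (cword Om J) /\ cword Om J =i J.
Proof.
move=> /acyclic_rank_exists[f fP]; apply/topo_acyclic_order; rewrite /cword.
case: xgetP => [//|none]; exfalso.
apply: (none (sort (relpre f leq) (enum J))); apply/topo_acyclic_order.
split; last by move=> s; rewrite mem_sort mem_enum.
rewrite /topo sort_uniq enum_uniq /=.
have tr : transitive (relpre f leq) by move=> a b c; apply: leq_trans.
have : pairwise (relpre f leq) (sort (relpre f leq) (enum J)).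
  by rewrite -sorted_pairwise // sort_sorted // => a b; apply: leq_total.
apply: (@sub_in_pairwise _ (mem J)); last by apply/allP => s; rewrite mem_sort mem_enum.
by move=> a b aJ bJ /=; rewrite leqNgt; apply: contra => /fP; apply.
Qed.

Lemma acyclic_ind J (P : S -> Prop) : acyclic Om J ->
  {in J, forall r, {in J, forall i, Om r i -> P i} -> P r} -> {in J, forall r, P r}.
Proof.
move=> /acyclic_rank_exists[f fP] h r.
elim: {r}_.+1 {-2}r (ltnSn (f r)) => // n IH r Hr rJ; apply: h => // i iJ ri.
by apply: IH => //; have := fP _ _ rJ iJ ri; lia.
Qed.

End Acyclic.

(** * The Euler form *)

Section Euler.
Variables (R : realType) (W : groupType) (S : finType) (C : coxeterSystem W S).
Variables (B : symCartan R C) (Om : orientation C).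
Local Notation V := (rootV S R).
Local Notation e := (simple_root R).
Local Notation wp := (word_prod (gen C)).
Local Notation g := (gen C).
Local Notation Bf := (bil B).
Local Notation act := (act C B).
Local Notation is_root := (is_root B).
Local Notation par := (parabolic C).
Local Notation topo := (topo Om).
Local Open Scope ring_scope.
Implicit Types (J K : {set S}) (s r : S) (p q : seq S).

Lemma B_nonedge s t : s != t -> Om s t = false -> Om t s = false -> B s t = 0.
Proof.
move=> st h1 h2; apply: B_nondiagram => //; apply: contraFN h1 => d.
by rewrite (orient_one Om d) h2.
Qed.

Lemma B_edge s t : Om s t -> B s t <= -1.
Proof. by move=> /orient_diagram; apply: B_diagram. Qed.

Definition euler_mx s t : R := (s == t)%:R + B s t * (Om s t)%:R.
Definition euler := bil euler_mx.

Lemma eulerBl x x' y : euler (x - x') y = euler x y - euler x' y.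
Proof. exact: bilBl. Qed.

Lemma eulerZl a x y : euler (a *: x) y = a * euler x y.
Proof. exact: bilZl. Qed.

Lemma euler_suml I (r : seq I) P (F : I -> V) y :
  euler (\sum_(i <- r | P i) F i) y = \sum_(i <- r | P i) euler (F i) y.
Proof. exact: bil_suml. Qed.

Lemma euler_mx_sym s t : euler_mx s t + euler_mx t s = B s t.
Proof.
rewrite /euler_mx (eq_sym t); have [<-|st] := eqVneq s t.
  by rewrite orient_irr B_diag mulr0 addr0 -natrD.
rewrite !add0r (sym_mxC B t) -mulrDr.
have [h|h] := boolP (Om s t); first by rewrite (orient_anti h) addr0 mulr1.
have [h'|h'] := boolP (Om t s); first by rewrite add0r mulr1.
by rewrite (B_nonedge st) ?mul0r //; apply: negbTE.
Qed.

Lemma eulerD x y : euler x y + euler y x = Bf x y.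
Proof.
rewrite /euler /bil [X in _ + X]exchange_big -big_split; apply: eq_bigr => s _.
rewrite -big_split; apply: eq_bigr => t _ /=.
by rewrite -(euler_mx_sym s t); ring.
Qed.

Lemma euler_el s y : euler (e s) y = y s + \sum_(t | Om s t) B s t * y t.
Proof.
rewrite /euler bil_el /euler_mx.
under eq_bigr do rewrite mulrDl.
rewrite big_split /=; congr (_ + _).
  rewrite (bigD1 s) //= eqxx mul1r big1 ?addr0 // => t ts.
  by rewrite eq_sym (negPf ts) mul0r.
by rewrite [RHS]big_mkcond; apply: eq_bigr => t _; case: ifP; rewrite ?mulr1 ?mulr0 ?mul0r.
Qed.

Lemma euler_el_first J s y : {in J, forall t, ~~ Om s t} -> supp J y ->
  euler (e s) y = y s.
Proof.
move=> h /suppP hy; rewrite euler_el big1 ?addr0 // => t st.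
by rewrite hy ?mulr0 //; apply: contraTN st => /h.
Qed.

Local Notation sp p := [set x in (p : seq S)]%SET.

Lemma supp_cons s p (x : V) : s \notin p -> supp (sp (s :: p)) x ->
  exists2 x' : V, supp (sp p) x' & x = x s *: e s + x'.
Proof.
move=> sn /suppP hx; exists (x - x s *: e s); last by rewrite addrC subrK.
apply/suppP => t; rewrite inE => tp; rewrite !ffunE.
have [->|ts] := eqVneq t s; first by rewrite /GRing.scale /= mulr1 subrr.
by rewrite scaler0 subr0 hx // !inE negb_or ts.
Qed.

Lemma supp_first s p (x : V) : s \notin p -> supp (sp p) x -> x s = 0.
Proof. by move=> sn /suppP; apply; rewrite inE. Qed.

Lemma topo_all s p : all (fun t => ~~ Om s t) p -> {in sp p, forall t, ~~ Om s t}.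
Proof. by move=> /allP h t; rewrite inE; apply: h. Qed.

Lemma euler_nondegenerate p x : topo p -> supp (sp p) x ->
  (forall r, r \in p -> euler x (e r) = 0) -> x = 0.
Proof.
elim: p x => [|s p IH] x.
  by move=> _ /suppP h _; apply/ffunP => s; rewrite h ?inE // ffunE.
rewrite topo_cons => /and3P[sn sall tp] hx h.
have [x' hx' xE] := supp_cons sn hx.
have x'0 : x' = 0.
  apply: IH => // r rp; have := h r; rewrite inE rp orbT => /(_ isT).
  rewrite xE /euler bilDl bilZl -/euler (euler_el_first (topo_all sall)).
    rewrite ffunE; have /negPf -> : s != r by apply: contraNneq sn => ->.
    by rewrite mulr0 add0r.
  by apply: supp_e; rewrite inE.
have := h s; rewrite inE eqxx => /(_ isT); rewrite xE x'0 addr0 /euler bilZl bil_ee.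
by rewrite /euler_mx eqxx orient_irr mulr0 addr0 mulr1 => ->; rewrite scale0r.
Qed.

Definition prefix_root p r := act (wp (take (index r p) p)) (e r).

Lemma prefix_root_head s p : prefix_root (s :: p) s = e s.
Proof. by rewrite /prefix_root /= eqxx take0 wp_nil act1. Qed.

Lemma prefix_root_tail s p r : s != r ->
  prefix_root (s :: p) r = act (g s) (prefix_root p r).
Proof. by move=> /negPf sr; rewrite /prefix_root /= sr /= wp_cons actM. Qed.

Lemma par_wp J p : {subset p <= J} -> par J (wp p).
Proof. by move=> h; exists p. Qed.

Lemma supp_prefix_root p r : r \in p -> supp (sp p) (prefix_root p r).
Proof.
move=> rp; apply: par_act_supp; last by apply: supp_e; rewrite inE.
by apply: par_wp => t /mem_take; rewrite inE.
Qed.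

Lemma euler_prefix_root p r y : topo p -> r \in p -> supp (sp p) y ->
  euler (prefix_root p r) y = y r.
Proof.
elim: p r y => // s p IH r y; rewrite topo_cons => /and3P[sn sall tp] rp hy.
have [y' hy' yE] := supp_cons sn hy.
have ss : euler (e s) (e s) = 1.
  by rewrite /euler bil_ee /euler_mx eqxx orient_irr mulr0 addr0.
have sE z : supp (sp p) z -> euler (e s) z = 0.
  by move=> hz; rewrite (euler_el_first (topo_all sall) hz) (supp_first sn hz).
have [<-|sr] := eqVneq s r.
  rewrite prefix_root_head yE /euler linearD linearZ /= -/euler ss sE // addr0.
  by rewrite !ffunE eqxx (supp_first sn hy') addr0.
have {}rp : r \in p by move: rp; rewrite inE eq_sym (negPf sr).
rewrite prefix_root_tail // act_gen; set x := prefix_root p r.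
have hx : supp (sp p) x by apply: supp_prefix_root.
have xs : euler x (e s) = Bf (e s) x by rewrite -eulerD (sE _ hx) add0r.
rewrite yE /euler linearD linearZ /= !(bilBl, bilZl) -/euler xs ss sE // IH //.
rewrite !ffunE eq_sym (negPf sr) /GRing.scale /=; ring.
Qed.

(* With respect to the Euler form, the Coxeter element acts as minus transposition. *)
Lemma euler_coxeter p y z : topo p -> supp (sp p) z ->
  euler (act (wp p) y) z = - euler z y.
Proof.
move=> tp hz.
suff [b hb bE] : exists2 b, supp (sp p) b & act (wp p) y = y - b /\
    forall r, r \in p -> euler b (e r) = Bf y (e r).
  case: bE => -> bE; rewrite /euler bilBl -/euler.
  have -> : euler b z = Bf y z; last by rewrite -(eulerD y z); ring.
  rewrite {1 2}(supp_sumE hz) /euler !linear_sum; apply: eq_bigr => r.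
  by rewrite inE => rp; rewrite !linearZ /= -/euler bE.
elim: p tp {z hz} => [|s p IH] => [_|].
  exists 0; first by apply/suppP => s; rewrite ffunE.
  by split=> //; rewrite wp_nil act1 subr0.
rewrite topo_cons => /and3P[sn sall tp]; have [b hb [bE hE]] := IH tp.
have sub : sp p \subset sp (s :: p).
  by apply/fintype.subsetP => t; rewrite !inE => ->; rewrite orbT.
exists (b + Bf (e s) (y - b) *: e s).
  by apply: suppD; [exact: suppS hb | apply: suppZ; apply: supp_e; rewrite inE mem_head].
rewrite wp_cons actM bE act_gen; split; first by rewrite opprD addrA.
have bs : euler b (e s) = Bf (e s) b.
  by rewrite -eulerD (euler_el_first (topo_all sall) hb) (supp_first sn hb) add0r.
move=> r; rewrite inE /euler bilDl bilZl -/euler.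
have [->|rs] := eqVneq r s => /= [_|rp].
  rewrite bs /euler bil_ee /euler_mx eqxx orient_irr linearB /= (BfC B y); ring.
rewrite hE // (euler_el_first (topo_all sall)) ?supp_e ?inE //.
by rewrite ffunE eq_sym (negPf rs) mulr0 addr0.
Qed.

Definition gam K r := prefix_root (cword Om K) r.

Lemma supp_eqi J p (x : V) : p =i J -> supp (sp p) x = supp J x.
Proof. by move=> pJ; congr supp; apply/setP => s; rewrite inE pJ. Qed.

Lemma supp_gam K r : acyclic Om K -> r \in K -> supp K (gam K r).
Proof.
move=> /cwordP[tp pK] rK; rewrite -(supp_eqi _ pK); apply: supp_prefix_root.
by rewrite pK.
Qed.

Lemma euler_gam K r y : acyclic Om K -> r \in K -> supp K y -> euler (gam K r) y = y r.
Proof.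
move=> /cwordP[tp pK] rK; rewrite -(supp_eqi _ pK) => hy.
by apply: euler_prefix_root; rewrite ?pK.
Qed.

Lemma euler_nondegenerate_set K x : acyclic Om K -> supp K x ->
  (forall r, r \in K -> euler x (e r) = 0) -> x = 0.
Proof.
move=> /cwordP[tp pK]; rewrite -(supp_eqi _ pK) => hx h.
by apply: euler_nondegenerate tp hx _ => r; rewrite pK; apply: h.
Qed.

Lemma prefix_root_gam K p r : topo p -> p =i K -> acyclic Om K -> r \in K ->
  prefix_root p r = gam K r.
Proof.
move=> tp pK aK rK; apply/eqP; rewrite -subr_eq0; apply/eqP.
apply: (euler_nondegenerate_set aK).
  apply: suppB; last exact: supp_gam.
  by rewrite -(supp_eqi _ pK) supp_prefix_root ?pK.
move=> i iK; rewrite /euler bilBl -/euler.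
by rewrite euler_prefix_root ?pK ?euler_gam ?subrr ?(supp_eqi _ pK) ?supp_e.
Qed.

Lemma gam_rec K r : acyclic Om K -> r \in K ->
  gam K r = e r - \sum_(i in K | Om r i) B r i *: gam K i.
Proof.
move=> aK rK; apply/eqP; rewrite -subr_eq0; apply/eqP.
have hs : supp K (\sum_(i in K | Om r i) B r i *: gam K i).
  by apply: supp_sum => i /andP[iK _]; apply/suppZ/supp_gam.
apply: (euler_nondegenerate_set aK).
  by apply: suppB; [apply: supp_gam | apply: suppB => //; apply: supp_e].
move=> j jK; rewrite /euler !bilBl bil_suml -/euler euler_gam ?supp_e //.
have -> : \sum_(i in K | Om r i) euler (B r i *: gam K i) (e j) = B r j * (Om r j)%:R.
  rewrite (eq_bigr (fun i => B r i * (e j) i)) => [|i /andP[iK _]]; last first.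
    by rewrite /euler bilZl -/euler euler_gam ?supp_e.
  have [rj|rj] := boolP (Om r j); last first.
    rewrite mulr0 big1 // => i /andP[_ ri]; rewrite ffunE.
    by case: eqP ri => [->|]; rewrite ?mulr0 // (negPf rj).
  rewrite (bigD1 j) ?jK //= ffunE eqxx big1 ?addr0 // => i /andP[_ ij].
  by rewrite ffunE (negPf ij) mulr0.
by rewrite /euler bil_ee /euler_mx ffunE eq_sym; ring.
Qed.

Lemma gam_ge0 K r : acyclic Om K -> r \in K -> pos (gam K r - e r).
Proof.
move=> aK; move: r; apply: (acyclic_ind aK) => r rK IH.
rewrite (gam_rec aK rK) addrAC subrr add0r -sumrN; apply: pos_sum => i /andP[iK ri].
rewrite -scaleNr; apply: posZ; first by have := B_edge ri; lra.
by rewrite -(subrK (e i) (gam K i)); apply: posD; [exact: IH | exact: pos_e].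
Qed.

Lemma root_gam K r : is_root (gam K r).
Proof. by apply/root_act/root_e. Qed.

Lemma gam_pos K r : acyclic Om K -> r \in K -> pos (gam K r).
Proof.
move=> aK rK; rewrite -(subrK (e r) (gam K r)).
by apply: posD; [exact: gam_ge0 | exact: pos_e].
Qed.

Lemma gam_coord1 K r : gam K r r = 1.
Proof.
have h : par (~: [set r])%SET (wp (take (index r (cword Om K)) (cword Om K))).
  apply: par_wp => t tt; rewrite !inE; apply: contraTneq tt => ->.
  by case: (boolP (r \in cword Om K)) => rK;
    [rewrite in_take ?ltnn // | apply: contra rK => /mem_take].
by rewrite /gam /prefix_root (par_act_out _ _ h) ?ffunE ?eqxx // !inE eqxx.
Qed.

End Euler.

(** * The sets J with c(J) <= w *)

Section Family.
Variables (R : realType) (W : groupType) (S : finType) (C : coxeterSystem W S).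
Variables (B : symCartan R C) (Om : orientation C).
Local Notation V := (rootV S R).
Local Notation e := (simple_root R).
Local Notation wp := (word_prod (gen C)).
Local Notation g := (gen C).
Local Notation len := (length C).
Local Notation Bf := (bil B).
Local Notation act := (act C B).
Local Notation desc := (desc C).
Local Notation is_root := (is_root B).
Local Notation par := (parabolic C).
Local Notation topo := (topo Om).
Local Notation gam := (gam B Om).
Local Notation acyclic := (acyclic Om).
Local Notation weak_le := (weak_le C).
Local Notation cOm := (cOm Om).
Local Open Scope ring_scope.
Implicit Types (J K L : {set S}) (s r : S) (p q : seq S) (u w : W).

Lemma weak_le_cons s u w : ~~ desc s u ->
  weak_le (g s * u) w = desc s w && weak_le u (g s * w).
Proof.
move=> su; rewrite /weak_le (ndesc_len su) invgM genV -mulgA.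
have [sw|sw] /= := boolP (desc s w); first by rewrite (desc_len sw) addSn eqSS.
apply/negbTE; rewrite neq_ltn; apply/orP; right.
have := lenM C u (u^-1 * (g s * w)); rewrite mulVKg (ndesc_len sw) addSn; apply: leqW.
Qed.

Lemma uniq_ndesc s p : s \notin p -> ~~ desc s (wp p).
Proof.
move=> sp; rewrite (desc_pos B) negbK.
have h : par [set x in p] (wp p) by exists p; split=> // t; rewrite inE.
apply: (@par_pos_out _ _ _ _ _ _ _ _ s (parV h)); first exact: root_e.
  by rewrite inE.
by rewrite ffunE eqxx.
Qed.

Lemma weak_le_word p w : uniq p -> weak_le (wp p) w =
  all (fun r => ~~ pos (act w^-1 (prefix_root B p r))) p.
Proof.
elim: p w => [|s p IH] w /=; first by rewrite wp_nil /weak_le len1 invg1 mul1g eqxx.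
case/andP => sp up; rewrite wp_cons weak_le_cons ?uniq_ndesc // IH //.
rewrite prefix_root_head (desc_pos B); congr (_ && _); apply: eq_in_all => r rp.
have sr : s != r by apply: contraNneq sp => ->.
by rewrite prefix_root_tail // invgM genV actM.
Qed.

Definition height (x : V) := \sum_s x s.
Definition phi w x := - height (act w^-1 x).

Lemma heightD x y : height (x + y) = height x + height y.
Proof. by rewrite -big_split; apply: eq_bigr => s _; rewrite ffunE. Qed.

Lemma heightZ a x : height (a *: x) = a * height x.
Proof. by rewrite mulr_sumr; apply: eq_bigr => s _; rewrite ffunE. Qed.

Lemma phiD w x y : phi w (x + y) = phi w x + phi w y.
Proof. by rewrite /phi actD heightD opprD. Qed.

Lemma phiZ w a x : phi w (a *: x) = a * phi w x.
Proof. by rewrite /phi actZ heightZ mulrN. Qed.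

Lemma phi0 w : phi w 0 = 0.
Proof. by rewrite -[0 in LHS](scale0r (0 : V)) phiZ mul0r. Qed.

Lemma phiB w x y : phi w (x - y) = phi w x - phi w y.
Proof. by rewrite phiD -scaleN1r phiZ mulN1r. Qed.

Lemma phi_sum w I (r : seq I) (P : pred I) (F : I -> V) :
  phi w (\sum_(i <- r | P i) F i) = \sum_(i <- r | P i) phi w (F i).
Proof. by apply: (big_morph (phi w)) => [x y|]; rewrite ?phiD ?phi0. Qed.

Lemma height_ge0 x : pos x -> 0 <= height x.
Proof. by move=> /posP h; apply: sumr_ge0. Qed.

Lemma height_gt0 x : is_root x -> pos x -> 0 < height x.
Proof.
move=> rx px; rewrite lt_neqAle height_ge0 // andbT eq_sym.
apply/eqP => /psumr_eq0P h; have /eqP := root_neq0 rx; apply.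
by apply/ffunP => s; rewrite ffunE h // => t _; apply: (posP _ px).
Qed.

Lemma phi_root w x : is_root x -> (0 < phi w x) = ~~ pos (act w^-1 x).
Proof.
move=> rx; have ra : is_root (act w^-1 x) by apply: root_act.
rewrite /phi oppr_gt0; have [h|h] /= := boolP (pos _).
  by apply/negbTE; rewrite -leNgt height_ge0.
rewrite -(root_posN ra) in h; have := height_gt0 (root_opp ra) h.
by rewrite -scaleN1r heightZ mulN1r oppr_gt0.
Qed.

Lemma phi_gen s w x : phi (g s * w) x = phi w x - Bf (e s) x * phi w (e s).
Proof.
have -> : phi (g s * w) x = phi w (act (g s) x) by rewrite /phi invgM genV actM.
by rewrite act_gen phiB phiZ.
Qed.

Lemma phi_desc s w : desc s w = (0 < phi w (e s)).
Proof. by rewrite phi_root ?(desc_pos B) //; apply: root_e. Qed.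

Lemma phi_gam_rec w K r : acyclic K -> r \in K ->
  phi w (gam K r) = phi w (e r) + \sum_(i in K | Om r i) (- B r i) * phi w (gam K i).
Proof.
move=> aK rK; rewrite {1}(gam_rec B aK rK) phiB phi_sum -sumrN; congr (_ + _).
by apply: eq_bigr => i _; rewrite phiZ mulNr.
Qed.

Definition fam w K := acyclic K && weak_le (cOm K) w.

Lemma famP w K : reflect (acyclic K /\ {in K, forall r, 0 < phi w (gam K r)}) (fam w K).
Proof.
apply: (iffP andP) => -[aK h]; split=> //; have [tp pK] := cwordP aK;
  have /andP[up _] := tp.
  move: h; rewrite /Defs.cOm weak_le_word // => /allP h r rK.
  by rewrite phi_root; [apply: h; rewrite pK | apply: root_gam].
rewrite /Defs.cOm weak_le_word //; apply/allP => r; rewrite pK => /h.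
by rewrite phi_root //; apply: root_gam.
Qed.

Lemma weak_le_refl u : weak_le u u.
Proof. by rewrite /weak_le mulVg len1 addn0. Qed.

Lemma fam_cOm K : acyclic K -> fam (cOm K) K.
Proof. by move=> aK; rewrite /fam aK weak_le_refl. Qed.

Lemma weak_le_eq u w : weak_le u w -> len u = len w -> u = w.
Proof.
rewrite /weak_le => /eqP h E; apply: (mulgI u^-1%g); rewrite mulVg.
by rewrite (@len_eq0 _ _ C (u^-1 * w)%g) //; lia.
Qed.

Lemma len_uniq_word p : uniq p -> len (wp p) = size p.
Proof.
elim: p => [|s p IH] /=; first by rewrite wp_nil len1.
by case/andP => sp /IH <-; rewrite wp_cons ndesc_len // uniq_ndesc.
Qed.

Lemma topo_word_cOm p K : acyclic K -> topo p -> p =i K -> wp p = cOm K.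
Proof.
move=> aK tp pK; have [tq qK] := cwordP aK.
have [/andP[up _] /andP[uq _]] := (tp, tq).
apply: weak_le_eq; last first.
  rewrite /Defs.cOm !len_uniq_word //; apply/eqP; rewrite -uniq_size_uniq //.
  by move=> s; rewrite pK qK.
have /famP[_ h] := fam_cOm aK.
rewrite weak_le_word //; apply/allP => r; rewrite pK => rK.
by rewrite (prefix_root_gam _ tp pK) // -phi_root ?h //; apply: root_gam.
Qed.

Lemma par_cOm K : acyclic K -> par K (cOm K).
Proof. by move=> /cwordP[_ pK]; apply: par_wp => s; rewrite pK. Qed.

(* The values of [phi w] on the roots of a Coxeter element increase with the set,
   since they satisfy the recursion [phi_gam_rec] with nonnegative coefficients. *)
Lemma fam_cover w L : acyclic L ->
  {in L, forall r, 0 < phi w (gam L r) \/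
     exists K, [/\ K \subset L, r \in K & fam w K]} ->
  fam w L.
Proof.
move=> aL h; apply/famP; split=> //.
suff main : {in L, forall r, 0 < phi w (gam L r) /\
    forall K, K \subset L -> fam w K -> r \in K -> phi w (gam K r) <= phi w (gam L r)}.
  by move=> r /main[].
apply: (acyclic_ind aL) => r rL IH.
have mono K : K \subset L -> fam w K -> r \in K -> phi w (gam K r) <= phi w (gam L r).
  move=> /[dup] KL /fintype.subsetP sKL /[dup] fK /famP[aK hK] rK; rewrite !phi_gam_rec //.
  rewrite lerD2l [leRHS](bigID (mem K)) /= -[leLHS]addr0; apply: lerD.
    have -> : \sum_(i | (i \in L) && Om r i && (i \in K)) - B r i * phi w (gam L i) =
        \sum_(i in K | Om r i) - B r i * phi w (gam L i).
      apply: eq_bigl => i; case iK : (i \in K); rewrite ?andbF ?andbT // (sKL i iK) //.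
    apply: ler_sum => i /andP[iK ri]; apply: ler_wpM2l.
      by have := B_edge B ri; lra.
    by have [_] := IH i (sKL i iK) ri; apply.
  apply: sumr_ge0 => i /andP[/andP[iL ri] _]; apply: mulr_ge0.
    by have := B_edge B ri; lra.
  by have [/ltW] := IH i iL ri.
split=> //; have [//|[K [KL rK fK]]] := h r rL.
by apply: lt_le_trans (mono K KL fK rK); have /famP[_] := fK; apply.
Qed.

Lemma fam_add w K s : acyclic (s |: K)%SET -> fam w K ->
  0 < phi w (gam (s |: K)%SET s) -> fam w (s |: K)%SET.
Proof.
move=> aL fK hs; apply: fam_cover => // r; rewrite !inE => /predU1P[->|rK]; first by left.
by right; exists K; split=> //; apply: finset.subsetUr.
Qed.

Lemma fam0 w : fam w finset.set0.
Proof.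
apply/famP; split; last by move=> r; rewrite inE.
by apply: (@acyclic_rank _ _ _ _ _ (fun=> 0%N)) => s; rewrite inE.
Qed.

Lemma JmaxP w : fam w (Jmax Om w) /\
  forall K, fam w K -> Jmax Om w \subset K -> K = Jmax Om w.
Proof.
rewrite /Jmax; case: pickP => [J /maxsetP[fJ max] //|none] /=.
have [J] := maxset_exists (P := fam w) (fam0 w).
by have := none J => /= ->.
Qed.

Lemma fam_gen_source w J s : fam w J -> s \in J -> {in J, forall t, ~~ Om s t} ->
  desc s w /\ fam (g s * w) (J :\ s)%SET.
Proof.
move=> /andP[aJ le] sJ smin.
have aJs : acyclic (J :\ s)%SET by apply: acyclicS aJ; apply: subsetDl.
have [tq qE] := cwordP aJs.
have sq : s \notin cword Om (J :\ s)%SET by rewrite qE !inE eqxx.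
have tp : topo (s :: cword Om (J :\ s)%SET).
  rewrite topo_cons sq tq andbT; apply/allP => t; rewrite qE !inE => /andP[_].
  exact: smin.
have pJ : s :: cword Om (J :\ s)%SET =i J.
  by move=> t; rewrite inE qE !inE; case: eqP => [->|].
move: le; rewrite -(topo_word_cOm aJ tp pJ) wp_cons weak_le_cons ?uniq_ndesc //.
by case/andP => sw le; rewrite /fam aJs.
Qed.

Lemma fam_gen_keep w K s : fam w K -> desc s w ->
  s \notin K \/ (exists2 i, i \in K & Om s i) -> fam (g s * w) K.
Proof.
move=> /famP[aK hK]; rewrite phi_desc => sw hs; apply/famP; split=> //.
pose f r := phi w (gam K r); pose f' r := phi (g s * w) (gam K r).
have lt_s : s \in K -> phi w (e s) < f s.
  move=> sK; case: hs => [|[i iK si]]; first by rewrite sK.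
  rewrite /f phi_gam_rec // ltrDl (bigD1 i) ?iK //=; apply: ltr_wpDr.
    apply: sumr_ge0 => j /andP[/andP[jK sj] _]; apply: mulr_ge0; last exact/ltW/hK.
    by have := B_edge B sj; lra.
  by apply: mulr_gt0; [have := B_edge B si; lra | exact: hK].
(* Passing from w to s w lowers only the value at s, by at most [phi w (e s)]. *)
suff main : {in K, forall r, if r == s then f s - phi w (e s) <= f' s
    else f r + (if Om s r then - B s r * phi w (e s) else 0) <= f' r}.
  move=> r rK; have := main r rK; case: eqP => [rs|_].
    by rewrite rs in rK *; have := lt_s rK; rewrite -/(f' s); lra.
  have fr : 0 < f r by apply: hK.
  rewrite -/(f' r); case: ifP => [sr|_]; last lra.
  have : 0 <= - B s r * phi w (e s).
    by apply: mulr_ge0; [have := B_edge B sr; lra | exact: ltW].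
  lra.
apply: (acyclic_ind aK) => r rK IH.
have f'E : f' r = phi (g s * w) (e r) + \sum_(i in K | Om r i) (- B r i) * f' i.
  by rewrite /f' phi_gam_rec.
have fE : f r = phi w (e r) + \sum_(i in K | Om r i) (- B r i) * f i.
  by rewrite /f phi_gam_rec.
have b_ge1 i j : Om i j -> 1 <= - B i j by move=> ij; have := B_edge B ij; lra.
have [rs|rs] := eqVneq r s.
  rewrite rs in rK f'E fE IH *; rewrite f'E fE phi_gen bil_ee B_diag.
  case: hs => [|[i iK si]]; first by rewrite rK.
  have le_sum : \sum_(i in K | Om s i) - B s i * f i + phi w (e s) <=
      \sum_(i in K | Om s i) - B s i * f' i.
    have termle j : j \in K -> Om s j ->
        - B s j * f j + - B s j * (- B s j * phi w (e s)) <= - B s j * f' j.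
      move=> jK sj; have js : j != s by apply: contraTneq sj => ->; rewrite orient_irr.
      have := IH j jK sj; rewrite (negPf js) sj -mulrDr => h.
      by apply: ler_wpM2l => //; have := b_ge1 _ _ sj; lra.
    rewrite (bigD1 i) ?iK //= [leRHS](bigD1 i) ?iK //=.
    have := termle i iK si; have := b_ge1 _ _ si.
    have : \sum_(j | (j \in K) && Om s j && (j != i)) - B s j * f j <=
       \sum_(j | (j \in K) && Om s j && (j != i)) - B s j * f' j.
      apply: ler_sum => j /andP[/andP[jK sj] _]; have := termle j jK sj.
      by have := b_ge1 _ _ sj; nra.
    have hbb : phi w (e s) <= - B s i * (- B s i * phi w (e s)).
      have b1 := b_ge1 _ _ si; rewrite mulrA ler_peMl //; first exact: ltW.
      by rewrite -[leLHS]mulr1 ler_pM.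
    lra.
  lra.
rewrite f'E fE phi_gen bil_ee.
have termle j : j \in K -> Om r j -> j != s -> - B r j * f j <= - B r j * f' j.
  move=> jK rj js; have := IH j jK rj; rewrite (negPf js).
  have b1 := b_ge1 _ _ rj; move=> h; apply: ler_wpM2l; first lra.
  move: h; case: ifP => [sj|_]; last lra.
  by have := b_ge1 _ _ sj; nra.
case: ifP => sr.
  have rsF : Om r s = false by apply: orient_anti.
  have : \sum_(i in K | Om r i) - B r i * f i <= \sum_(i in K | Om r i) - B r i * f' i.
    apply: ler_sum => j /andP[jK rj]; apply: termle => //.
    by apply: contraTneq rj => ->; rewrite rsF.
  lra.
have [rsT|rsF] := boolP (Om r s && (s \in K)).
  case/andP: rsT => rsT sK.
  rewrite (bigD1 s) ?sK //= [X in _ <= _ + X](bigD1 s) ?sK //=.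
  have : \sum_(i | (i \in K) && Om r i && (i != s)) - B r i * f i <=
     \sum_(i | (i \in K) && Om r i && (i != s)) - B r i * f' i.
    by apply: ler_sum => j /andP[/andP[jK rj] js]; apply: termle.
  have := IH s sK rsT; rewrite eqxx => hs'.
  have : - B r s * (f s - phi w (e s)) <= - B r s * f' s.
    by apply: ler_wpM2l => //; have := b_ge1 _ _ rsT; lra.
  rewrite (sym_mxC B r s).
  by nra.
have : \sum_(i in K | Om r i) - B r i * f i <= \sum_(i in K | Om r i) - B r i * f' i.
  apply: ler_sum => j /andP[jK rj]; apply: termle => //.
  by apply: contraNneq rsF => <-; rewrite rj jK.
have : B s r <= 0 by apply: B_le0; rewrite eq_sym.
by nra.
Qed.

Lemma phi_reflection z w : is_root z -> pos z -> 0 < phi w z ->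
  exists2 w', (len w' < len w)%N & forall x, phi w' x = phi w x - Bf z x * phi w z.
Proof.
move=> rz pz; rewrite phi_root // => nz; have [a [s zE]] := rz; rewrite zE in pz nz *.
exists (a * g s * a^-1 * w)%g; first exact: reflection_len nz.
move=> x; rewrite -phiZ -phiB -act_reflection /phi; congr (- height _).
by rewrite -actM; congr (act _ x); rewrite !invgM invgK genV !mulgA.
Qed.

(* Two roots with this inner product generate an infinite dihedral group, all of
   whose positive roots would be inversions of w. *)
Lemma no_dihedral x y w : is_root x -> is_root y -> pos x -> pos y ->
  Bf x y <= -2 -> phi w (x + y) <= 0.
Proof.
move=> rx ry px py xy; elim: {w}_.+1 {-2}w (ltnSn (len w)) => // n IH w Hw.
rewrite leNgt; apply/negP => p.
have [h|h] := ltP 0 (phi w x).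
  have [w' lw E] := phi_reflection rx px h; have := IH w' (leq_trans lw Hw).
  by rewrite E linearD /= (root_norm rx); move: p; nra.
have h' : 0 < phi w y by move: p; rewrite phiD; lra.
have [w' lw E] := phi_reflection ry py h'; have := IH w' (leq_trans lw Hw).
by rewrite E linearD /= (root_norm ry) (BfC B y); move: p; nra.
Qed.

Lemma fam_add_acyclic w K s : fam w K -> desc s w -> s \notin K ->
  acyclic (s |: K)%SET.
Proof.
move=> /famP[aK hK]; rewrite phi_desc => sw sK.
pose D := [set j in K | [exists a in K, Om a s && (1 <= gam K j a)]]%SET.
have DK j : j \in D -> j \in K by rewrite inE => /andP[].
have D0 a : a \in K -> Om a s -> a \in D.
  move=> aK' as_; rewrite inE aK'; apply/existsP; exists a; rewrite aK' as_ /=.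
  by have /posP/(_ a) := gam_ge0 B aK aK'; rewrite !ffunE eqxx subr_ge0.
have DS i j : i \in D -> j \in K -> Om j i -> j \in D.
  move=> iD jK ji; have iK := DK i iD; rewrite inE jK.
  move: iD; rewrite inE iK => /existsP[a /and3P[aK' as_ ia]].
  apply/existsP; exists a; rewrite aK' as_ /=; apply: le_trans ia _.
  have -> : gam K j a = e j a + \sum_(k in K | Om j k) (- B j k) * gam K k a.
    rewrite {1}(gam_rec B aK jK) !ffunE sum_ffunE -sumrN; congr (_ + _).
    by apply: eq_bigr => k _; rewrite ffunE mulNr.
  have g0 k : k \in K -> 0 <= gam K k a by move=> kK; apply: (posP _ (gam_pos B aK kK)).
  rewrite (bigD1 i) ?iK //= addrCA; apply: ler_wpDr.
    apply: addr_ge0; first exact: (posP _ (pos_e R j)).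
    apply: sumr_ge0 => k /andP[/andP[kK jk] _]; apply: mulr_ge0; last exact: g0.
    by have := B_edge B jk; lra.
  by apply: ler_peMl; [exact: g0 | have := B_edge B ji; lra].
have Dend b : b \in D -> ~~ Om s b.
  move=> bD; have bK := DK b bD; apply/negP => sb.
  move: bD; rewrite inE bK => /existsP[a /and3P[aK' as_ ba]].
  have : Bf (e s) (gam K b) <= -2.
    rewrite bil_el (bigD1 b) //= (bigD1 a) /=; last first.
      by apply: contraTneq as_ => ->; rewrite (orient_anti sb).
    have : \sum_(i | (i != b) && (i != a)) B s i * gam K b i <= 0.
      apply: sumr_le0 => i _; have [<-|si] := eqVneq s i.
        by have /suppP/(_ _ sK) -> := supp_gam B aK bK; rewrite mulr0.
      apply: mulr_le0_ge0; [exact: B_le0 | exact: (posP _ (gam_pos B aK bK))].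
    have : B s b * gam K b b <= -1.
      have := B_edge B sb; have /posP/(_ b) := gam_ge0 B aK bK.
      by rewrite !ffunE eqxx subr_ge0; set u := gam K b b; rewrite -[true%:R]/(1 : R); nra.
    have : B s a * gam K b a <= -1.
      by have := B_edge B as_; rewrite sym_mxC; move: ba; set u := gam K b a; nra.
    lra.
  move=> /(@no_dihedral _ _ w (root_e B s) (root_gam B Om K b) (pos_e R s) (gam_pos B aK bK)).
  by rewrite phiD; have := hK b bK; lra.
clearbody D; have [f fP] := acyclic_rank_exists aK.
pose N := (\max_(i in K) f i).+1.
have fN i : i \in K -> (f i < N)%N by move=> iK; rewrite ltnS; apply: leq_bigmax_cond.
apply: (@acyclic_rank _ _ _ _ _ (fun i => if i == s then N else
  if i \in D then N.+1 + f i else f i)%N) => i j.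
have neK i' : i' \in K -> (i' == s) = false by move=> iK; apply: contraNF sK => /eqP <-.
rewrite !inE => /predU1P[->|iK] /predU1P[->|jK] ij.
- by rewrite orient_irr in ij.
- by rewrite eqxx neK //; case: ifP => [/Dend|_]; [rewrite ij | apply: fN].
- by rewrite eqxx neK // D0 // leq_addr.
rewrite !neK //; case: ifP => jD.
  by rewrite (DS j i) // ltn_add2l fP.
case: ifP => _; last exact: fP.
by apply: leq_trans (fN j jK) _; apply: leq_trans (leq_addr _ _); apply: leqnSn.
Qed.

Lemma fam_add_desc w K s : fam w K -> desc s w -> s \notin K -> fam w (s |: K)%SET.
Proof.
move=> fK sw sK; have aL := fam_add_acyclic fK sw sK.
apply: fam_cover => // r; rewrite !inE => /predU1P[->|rK].
  right; exists [set s]%SET; split; rewrite ?finset.sub1set ?inE ?eqxx //.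
  have a1 : acyclic [set s]%SET.
    by apply: acyclicS aL; rewrite finset.sub1set !inE eqxx.
  apply/famP; split=> // t; rewrite inE => /eqP->.
  rewrite phi_gam_rec ?inE // big1 ?addr0 -?phi_desc // => i.
  by rewrite inE => /andP[/eqP->]; rewrite orient_irr.
by right; exists K; split=> //; apply: finset.subsetUr.
Qed.

Lemma fam_setU w J K : fam w J -> fam w K -> fam w (J :|: K)%SET.
Proof.
suff main : forall w J K, fam w J -> fam w K -> acyclic (J :|: K)%SET.
  move=> fJ fK; apply: fam_cover (main w J K fJ fK) _ => r; rewrite inE => /orP[rJ|rK]; right.
    by exists J; split=> //; apply: finset.subsetUl.
  by exists K; split=> //; apply: finset.subsetUr.
move=> {}w; elim: {w}_.+1 {-2}w (ltnSn (len w)) => // n IH w Hw {}J {}K fJ fK.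
have [->|J0] := eqVneq J finset.set0; first by rewrite finset.set0U; case/famP: fK.
have [aJ _] := famP _ _ fJ; have [s sJ smin] := acyclic_source J0 aJ.
have [sw fJs] := fam_gen_source fJ sJ smin.
have lw : (len (g s * w)%g < n)%N by have := desc_len sw; lia.
wlog sK : K fK / s \in K => [H|].
  have [sK|sK] := boolP (s \in K); first exact: H.
  apply: acyclicS (H (s |: K)%SET _ _); rewrite ?finset.setUS ?finset.subsetUr ?inE ?eqxx //.
  exact: fam_add_desc.
have [/existsP[i /andP[iK si]]|] := boolP [exists i in K, Om s i].
  have fK' : fam (g s * w) K by apply: fam_gen_keep => //; right; exists i.
  apply: acyclicS (IH _ lw _ _ fJs fK'); apply/fintype.subsetP => t; rewrite !inE.
  by have [->|_ /=] := eqVneq t s; rewrite ?sK ?orbT.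
rewrite negb_exists => /forallP Kmin.
have smin' : {in K, forall t, ~~ Om s t} by move=> t tK; have := Kmin t; rewrite tK.
have [_ fK'] := fam_gen_source fK sK smin'.
have aU := IH _ lw _ _ fJs fK'.
have -> : (J :|: K = s |: (J :\ s :|: K :\ s))%SET.
  by apply/setP => t; rewrite !inE; have [->|] := eqVneq t s; rewrite ?sJ.
apply: acyclic_setU1_source aU _ => t; rewrite !inE => /orP[]/andP[_].
  exact: smin.
exact: smin'.
Qed.

Lemma fam_Jmax w K : fam w K -> K \subset Jmax Om w.
Proof.
have [fJ max] := JmaxP w; move=> fK.
by rewrite -(max _ (fam_setU fJ fK)) ?finset.subsetUl // finset.subsetUr.
Qed.

End Family.

(** * The cone vectors, block by block *)

Section Projection.
Variables (R : realType) (W : groupType) (S : finType) (C : coxeterSystem W S).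
Variables (B : symCartan R C) (Om : orientation C).
Local Notation V := (rootV S R).
Local Notation g := (gen C).
Local Notation len := (length C).
Local Notation act := (act C B).
Local Notation desc := (desc C).
Local Notation is_root := (is_root B).
Local Notation par := (parabolic C).
Local Notation gam := (gam B Om).
Local Notation acyclic := (acyclic Om).
Local Notation weak_le := (weak_le C).
Local Notation cOm := (cOm Om).
Local Notation Jmax := (Jmax Om).
Local Notation fam := (fam Om).
Local Notation euler := (euler B Om).
Local Notation step := (sort_step Om).
Local Open Scope ring_scope.
Implicit Types (J K L : {set S}) (s r : S) (p q : seq S) (u v w : W).

Lemma par_fam J w K : par J w -> fam w K -> K \subset J.
Proof.
move=> wJ /(famP B)[aK hK]; apply/fintype.subsetP => r rK; apply: contraT => rJ.
have := hK r rK; rewrite phi_root; last exact: root_gam.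
by rewrite (par_pos_out (parV wJ) (root_gam B Om K r) rJ) // gam_coord1.
Qed.

Lemma Jmax_fam w : fam w (Jmax w).
Proof. by have [] := JmaxP B Om w. Qed.

Lemma Jmax_acyclic w : acyclic (Jmax w).
Proof. by have /andP[] := Jmax_fam w. Qed.

Lemma Jmax_eq0 w : Jmax w = finset.set0 -> w = 1%g.
Proof.
move=> J0; apply: contrapT => /eqP/(@exists_desc _ _ C)[s sw].
have s0 : s \notin (finset.set0 : {set S}) by rewrite inE.
have := fam_Jmax B (fam_add_desc B (fam0 B Om w) sw s0).
by rewrite J0 => /fintype.subsetP/(_ s); rewrite !inE eqxx => /(_ isT).
Qed.

Lemma fam1 K : fam 1%g K -> K = finset.set0.
Proof.
move=> /(famP B)[aK hK]; apply/setP => r; rewrite inE; apply/negP => rK.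
by have := hK r rK; rewrite phi_root ?invg1 ?act1 ?gam_pos //; apply: root_gam.
Qed.

Lemma len_cOm K : acyclic K -> len (cOm K) = #|K|.
Proof.
move=> /cwordP[/andP[uq _] qK]; rewrite /Defs.cOm (len_uniq_word B) //.
by rewrite -(card_uniqP uq); apply: eq_card.
Qed.

Lemma len_fam w K : fam w K -> (len ((cOm K)^-1 * w)%g + #|K| = len w)%N.
Proof. by move=> /andP[aK /eqP <-]; rewrite len_cOm // addnC. Qed.

Lemma step_len v : v != 1%g -> (len (step v) < len v)%N.
Proof.
move=> v1; have := len_fam (Jmax_fam v).
have : #|Jmax v| != 0%N by apply: contra v1 => /eqP/cards0_eq/Jmax_eq0->.
rewrite /sort_step; lia.
Qed.

Lemma step1 : step 1 = 1%g.
Proof.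
have E := fam1 (Jmax_fam 1); have := len_fam (Jmax_fam 1).
by rewrite E cards0 addn0 len1 -E => /len_eq0.
Qed.

Lemma inversions_monotone u w x : weak_le u w -> is_root x -> pos x ->
  ~~ pos (act u^-1 x) -> ~~ pos (act w^-1 x).
Proof.
elim/(@length_ind _ _ C): u w x => [|s u su IH] w x; first by rewrite invg1 act1 => _ _ ->.
have su' : ~~ desc s (g s * u)%g by rewrite descN su.
rewrite -{1 2}(genK C s u) weak_le_cons // => /andP[sw le] rx px.
have [h|h] := boolP (pos (act (g s) x)); last first.
  by move=> _; rewrite (pos_act_gen rx px h) -(desc_pos B).
rewrite invgM genV actM => nu; have := IH _ _ le (root_act (g s) rx) h nu.
by rewrite invgM genV -actM -mulgA gen_sq mulg1.
Qed.

Lemma sortable_step v : sortable Om v -> sortable Om (step v).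
Proof. by move=> h i; have := h i.+1; rewrite !iterSr. Qed.

Lemma sortable_Jmax v : sortable Om v -> Jmax (step v) \subset Jmax v.
Proof. by move=> h; have := h 0%N. Qed.

(* [cvec] is C_Omega(v) and [last_root] the root of the last occurrence of a letter
   in the sorting word, both computed block by block. *)
Fixpoint cvec n v r : V :=
  if n is n'.+1 then
    if r \in Jmax v then act (cOm (Jmax v)) (cvec n' (step v) r)
    else gam (r |: Jmax v)%SET r
  else gam (r |: Jmax v)%SET r.

Fixpoint last_root n v r : V :=
  if n is n'.+1 then
    if r \in Jmax (step v) then act (cOm (Jmax v)) (last_root n' (step v) r)
    else gam (Jmax v) r
  else 0.

Lemma cvec_out n v r : r \notin Jmax v -> cvec n v r = gam (r |: Jmax v)%SET r.
Proof. by case: n => //= n /negPf ->. Qed.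

Lemma root_cvec n v r : is_root (cvec n v r).
Proof.
elim: n v => [|n IH] v /=; first exact: root_gam.
by case: ifP => _; [apply/root_act/IH | apply: root_gam].
Qed.

Lemma len0_Jmax v : (len v <= 0)%N -> Jmax v = finset.set0.
Proof. by rewrite leqn0 => /eqP/len_eq0 ->; apply/fam1/Jmax_fam. Qed.

Lemma step_fuel n v : (len v <= n.+1)%N -> (len (step v) <= n)%N.
Proof.
have [->|v1] := eqVneq v 1%g; first by rewrite step1 len1.
by have := step_len v1; lia.
Qed.

Lemma supp_last_root n v r : sortable Om v -> (len v <= n)%N -> r \in Jmax v ->
  supp (Jmax v) (last_root n v r).
Proof.
elim: n v => [|n IH] v hv lv rJ; first by rewrite len0_Jmax ?inE in rJ.
rewrite /=; case: ifP => rJ2; last exact/supp_gam/rJ/Jmax_acyclic.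
apply: par_act_supp; first exact: (par_cOm (Jmax_acyclic v)).
by apply: (suppS (sortable_Jmax hv)); apply: IH => //; [apply: sortable_step | apply: step_fuel].
Qed.

Lemma supp_cvec n v J r : sortable Om v -> (len v <= n)%N ->
  Jmax v \subset J -> acyclic J -> r \in J -> supp J (cvec n v r).
Proof.
elim: n v => [|n IH] v hv lv vJ aJ rJ.
  have rJ' : [set r]%SET \subset J by rewrite finset.sub1set.
  rewrite /= len0_Jmax // finset.setU0; apply: (suppS rJ').
  by apply: supp_gam; [exact: acyclicS rJ' aJ | rewrite inE].
rewrite /=; case: ifP => rv.
  apply: par_act_supp; first exact: (parS vJ (par_cOm (Jmax_acyclic v))).
  apply: IH => //; [exact: sortable_step | exact: step_fuel |].
  exact: fintype.subset_trans (sortable_Jmax hv) vJ.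
have KJ : (r |: Jmax v)%SET \subset J by rewrite finset.subUset finset.sub1set rJ.
by apply: (suppS KJ); apply: supp_gam; [apply: acyclicS KJ aJ | rewrite !inE eqxx].
Qed.

Lemma last_root_sign n v r : sortable Om v -> (len v <= n)%N -> r \in Jmax v ->
  [/\ is_root (last_root n v r), pos (last_root n v r) &
      ~~ pos (act v^-1 (last_root n v r))].
Proof.
elim: n v => [|n IH] v hv lv rJ; first by rewrite len0_Jmax ?inE in rJ.
have aJ := Jmax_acyclic v; have fJ := Jmax_fam v.
rewrite /=; case: ifP => rJ2; last first.
  have rg := root_gam B Om (Jmax v) r.
  have /(famP B)[_ h] := fJ.
  by split; [| exact: gam_pos | rewrite -phi_root ?h].
have [rx px nx] := IH _ (sortable_step hv) (step_fuel lv) rJ2.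
have stepV x : act (step v)^-1 x = act v^-1 (act (cOm (Jmax v)) x).
  by rewrite /sort_step invgM invgK actM.
rewrite stepV in nx; split=> //; first exact: root_act.
apply: contraT => n1; have rc := root_act (cOm (Jmax v)) rx.
have /andP[_ le] := fJ.
have := inversions_monotone le (root_opp rc); rewrite (root_posN rc) => /(_ n1).
rewrite !actN actK (root_posN rx) (root_posN (root_act v^-1 rc)) negbK px.
by rewrite (negPf nx) => /(_ isT).
Qed.

Lemma cvec_expansion n v z : sortable Om v -> (len v <= n)%N -> supp (Jmax v) z ->
  z = - \sum_(r in Jmax v) euler z (last_root n v r) *: cvec n v r.
Proof.
elim: n v z => [|n IH] v z hv lv hz.
  rewrite len0_Jmax // in hz *; rewrite big1 ?oppr0 => [|r]; last by rewrite inE.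
  by apply/ffunP => s; rewrite (suppP _ _ hz) ?inE // ffunE.
have hv2 := sortable_step hv; have lv2 := step_fuel lv.
set J := Jmax v in hz *; set J2 := Jmax (step v).
have aJ : acyclic J := Jmax_acyclic v.
have JJ : J2 \subset J := sortable_Jmax hv.
have cJ := par_cOm aJ; set c := cOm J in cJ.
pose y := act c^-1 z.
have hy : supp J y by apply: par_act_supp hz; apply: parV.
have zE : z = act c y by rewrite actVK.
have cox x0 x : supp J x -> euler (act c x0) x = - euler x x0.
  move=> hx; have [tp pJ] := cwordP aJ; rewrite /c /Defs.cOm.
  by apply: euler_coxeter => //; rewrite (supp_eqi _ pJ).
pose gam2 r := gam (r |: J2)%SET r.
have KJ r : r \in J -> (r |: J2)%SET \subset J.
  by move=> rJ; rewrite finset.subUset finset.sub1set rJ.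
have aK r : r \in J -> acyclic (r |: J2)%SET by move=> rJ; apply: acyclicS (KJ r rJ) aJ.
have rK r : r \in (r |: J2)%SET by rewrite !inE eqxx.
pose y' := y - \sum_(r in J | r \notin J2) y r *: gam2 r.
have hy' : supp J2 y'.
  apply/suppP => t tJ2; rewrite !ffunE sum_ffunE.
  have [tJ|tJ] := boolP (t \in J); last first.
    rewrite (suppP _ _ hy) // big1 ?oppr0 ?addr0 // => r /andP[rJ _].
    have h : supp J (gam2 r) by apply: suppS (KJ r rJ) _; apply: supp_gam => //; apply: aK.
    by rewrite ffunE (suppP _ _ h) // scaler0.
  rewrite (bigD1 t) ?tJ //= ffunE gam_coord1 /GRing.scale /= mulr1 big1 ?addr0 ?subrr //.
  move=> r /andP[/andP[rJ rJ2] rt].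
  have /suppP/(_ t) := supp_gam B (aK r rJ) (rK r).
  rewrite !inE negb_or eq_sym rt tJ2 ffunE => /(_ isT) ->.
  by rewrite scaler0.
have E1 r : r \in J2 -> euler z (last_root n.+1 v r) = euler y' (last_root n (step v) r).
  move=> rJ2; have hl := supp_last_root hv2 lv2 rJ2.
  rewrite /= rJ2 zE cox; last by apply: par_act_supp cJ _; apply: suppS JJ hl.
  rewrite cox // opprK /y' eulerBl euler_suml big1 ?subr0 //.
  move=> t /andP[tJ tJ2]; rewrite eulerZl euler_gam ?aK //.
    by rewrite (suppP _ _ hl) ?mulr0.
  by apply: suppS hl; apply: finset.subsetUr.
have E2 r : r \in J -> r \notin J2 -> euler z (last_root n.+1 v r) = - y r.
  move=> rJ rJ2; rewrite /= (negPf rJ2) zE cox; last exact: supp_gam.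
  by rewrite euler_gam.
have := IH _ _ hv2 lv2 hy'; rewrite -/J2 => y'E.
have yE : y = \sum_(r in J | r \notin J2) y r *: gam2 r + y' by rewrite addrC subrK.
have split F : \sum_(r in J) F r =
    \sum_(r in J2) F r + \sum_(r in J | r \notin J2) F r :> V.
  rewrite (bigID (mem J2)) /=; congr (_ + _); apply: eq_bigl => r.
  by case rJ2 : (r \in J2); rewrite ?andbF // (fintype.subsetP JJ).
rewrite [LHS]zE [in LHS]yE actD act_sum y'E actN act_sum split opprD addrC.
congr (_ + _); first congr (- _).
  apply: eq_bigr => r rJ2; rewrite E1 // actZ /=.
  by rewrite -/J (fintype.subsetP JJ _ rJ2).
rewrite -sumrN; apply: eq_bigr => r /andP[rJ rJ2].
by rewrite E2 // scaleNr opprK actZ /= -/J rJ cvec_out.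
Qed.

End Projection.

(** * The projection *)

Section Projection.
Variables (R : realType) (W : groupType) (S : finType) (C : coxeterSystem W S).
Variables (B : symCartan R C) (Om : orientation C).
Local Notation g := (gen C).
Local Notation len := (length C).
Local Notation act := (act C B).
Local Notation is_root := (is_root B).
Local Notation par := (parabolic C).
Local Notation gam := (gam B Om).
Local Notation acyclic := (acyclic Om).
Local Notation cOm := (cOm Om).
Local Notation Jmax := (Jmax Om).
Local Notation fam := (fam Om).
Local Notation phi := (phi B).
Local Notation step := (sort_step Om).
Local Notation cvec := (cvec B Om).
Local Open Scope ring_scope.
Implicit Types (J K L : {set S}) (s r : S) (p q : seq S) (u v w : W).


Lemma acyclic_setU1_Jmax v r : r \in Jmax v -> acyclic (r |: Jmax v)%SET.
Proof.
move=> rJ; have -> : (r |: Jmax v = Jmax v)%SET by apply/finset.setUidPr; rewrite finset.sub1set.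
exact: (Jmax_acyclic B).
Qed.

(* By the expansion, minus each root of the Coxeter element of J(v) is a nonnegative
   combination of the [cvec]. *)
Lemma cvec_pos_fam n v w : sortable Om v -> (len v <= n)%N ->
  {in Jmax v, forall r, pos (act w^-1 (cvec n v r))} -> fam w (Jmax v).
Proof.
move=> hv lv h; have aJ := Jmax_acyclic B Om v; apply/(famP B); split=> // j jJ.
have rg := root_gam B Om (Jmax v) j.
have p : pos (act w^-1 (- gam (Jmax v) j)).
  rewrite (cvec_expansion B hv lv (supp_gam B aJ jJ)) opprK act_sum.
  apply: pos_sum => r rJ; rewrite actZ; apply: posZ; last exact: h.
  rewrite euler_gam //; last exact: supp_last_root.
  by have [_ /posP] := last_root_sign B hv lv rJ.
rewrite phi_root //; apply: contraL p => p.
by rewrite actN (root_posN (root_act _ rg)) negbK.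
Qed.

Section Step.
Variable w : W.
Let J := Jmax w.
Let w2 := ((cOm J)^-1 * parabolic_part C J w)%g.

Lemma fam_parabolic_part K : K \subset J -> fam w K -> fam (parabolic_part C J w) K.
Proof.
move=> KJ /(famP B)[aK h]; apply/(famP B); split=> // r rK.
have [_ _ sgn] := parabolic_partP B J w; have rg := root_gam B Om K r.
by rewrite phi_root // sgn -?phi_root ?h //; apply: suppS KJ _; apply: supp_gam.
Qed.

Lemma par_proj_step : par J w2.
Proof.
have [h _ _] := parabolic_partP B J w; apply: parM h; apply/parV/(par_cOm).
exact: (Jmax_acyclic B).
Qed.

Lemma len_proj_step : w != 1%g -> (len w2 < len w)%N.
Proof.
move=> w1; have [_ lp _] := parabolic_partP B J w.
have := len_fam B (fam_parabolic_part (fintype.subxx _) (Jmax_fam B Om w)).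
have : #|J| != 0%N by apply: contra w1 => /eqP/cards0_eq/(Jmax_eq0 B)->.
by rewrite -/J /w2; lia.
Qed.

Lemma pos_proj_step x : is_root x -> supp J x ->
  pos (act w2^-1 x) = pos (act w^-1 (act (cOm J) x)).
Proof.
move=> rx sx; have [_ _ sgn] := parabolic_partP B J w.
have aJ := Jmax_acyclic B Om w.
rewrite /w2 invgM invgK actM sgn //; first exact: root_act.
exact: par_act_supp (par_cOm aJ) sx.
Qed.

End Step.

Local Notation prec := (pi_down_rec Om).

Lemma precS n w : w != 1%g -> prec n.+1 w =
  (cOm (Jmax w) * prec n ((cOm (Jmax w))^-1 * parabolic_part C (Jmax w) w))%g.
Proof. by move=> /= /negPf ->. Qed.

Lemma prec1 n : prec n 1%g = 1%g.
Proof. by case: n => //= n; rewrite eqxx. Qed.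

Lemma par_prec n w : par (Jmax w) (prec n w).
Proof.
elim: n w => [|n IH] w; first exact: par1.
have [->|w1] := eqVneq w 1%g; first by rewrite prec1; apply: par1.
rewrite precS //; apply: parM; first exact: (par_cOm (Jmax_acyclic B Om w)).
apply: parS (IH _); apply: (par_fam B (par_proj_step w)).
exact: (Jmax_fam B).
Qed.

Lemma pos_prec n w x : is_root x -> pos x -> pos (act w^-1 x) -> pos (act (prec n w)^-1 x).
Proof.
elim: n w x => [|n IH] w x rx px pw; first by rewrite invg1 act1.
have [->|w1] := eqVneq w 1%g; first by rewrite prec1 invg1 act1.
have aJ := Jmax_acyclic B Om w; have cJ := par_cOm aJ.
have [sx|] := boolP (supp (Jmax w) x); last first.
  rewrite negb_forall => /existsP[s]; rewrite negb_imply => /andP[sJ xs].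
  apply: (@par_pos_out _ _ _ _ _ _ _ _ s (parV (par_prec n.+1 w))) => //.
  by rewrite lt_neqAle eq_sym xs (posP _ px).
have [|p1] := boolP (pos (act (cOm (Jmax w))^-1 x)); last first.
  have /andP[_ le] := Jmax_fam B Om w.
  by have := inversions_monotone le rx px p1; rewrite pw.
move=> p1; rewrite precS // invgM actM; apply: IH => //; first exact: root_act.
rewrite pos_proj_step ?actVK //; first exact: root_act.
by apply: par_act_supp sx; apply: parV.
Qed.

Lemma gam_pred_closed J K r : acyclic J -> K \subset J ->
  {in K & J, forall i j, Om i j -> j \in K} -> r \in K -> gam K r = gam J r.
Proof.
move=> aJ /[dup] KJ /fintype.subsetP sKJ cl; move: r.
apply: (acyclic_ind (acyclicS KJ aJ)) => r rK IH.
rewrite (gam_rec B (acyclicS KJ aJ) rK) (gam_rec B aJ (sKJ r rK)); congr (_ - _).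
rewrite [RHS](eq_bigl (fun i => (i \in K) && Om r i)) => [|i].
  by apply: eq_bigr => i /andP[iK ri]; rewrite IH.
have [ri|] := boolP (Om r i); last by rewrite !andbF.
by rewrite !andbT; apply/idP/idP => [iJ|/sKJ//]; apply: cl ri.
Qed.

Lemma fam_between w K J : fam w K -> fam w J -> K \proper J ->
  exists r, [/\ r \in J, r \notin K & fam w (r |: K)%SET].
Proof.
move=> fK fJ /properP[/fintype.subsetP KJ [r0 r0J r0K]].
have [aJ hJ] := famP B _ _ _ fJ; have [f fP] := acyclic_rank_exists aJ.
pose P := [pred r | (r \in J) && (r \notin K)].
have Pr0 : P r0 by rewrite /= r0J.
case: (arg_minnP f Pr0) => r /andP[rJ rK] min; exists r; split=> //.
pose L := (r |: [set t in J | (f t < f r)%N])%SET.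
have LJ : L \subset J.
  by apply/fintype.subsetP => t; rewrite !inE => /predU1P[->|/andP[]].
have fL : fam w L.
  apply/(famP B); split; first exact: acyclicS LJ aJ.
  move=> t tL; rewrite (gam_pred_closed aJ LJ) ?hJ ?(fintype.subsetP LJ) // => i j.
  rewrite !inE => /predU1P[->|/andP[iJ fi]] jJ ij; rewrite jJ /=.
    by rewrite fP ?orbT.
  by rewrite (ltn_trans (fP _ _ iJ jJ ij)) ?orbT.
have -> : (r |: K = L :|: K)%SET; last exact: (fam_setU B).
apply/setP => t; rewrite !inE; case: eqP => //= _.
apply/idP/idP => [->|/orP[/andP[tJ ft]|//]]; first by rewrite orbT.
by apply: contraLR ft => tK; rewrite -leqNgt; apply: min; rewrite /= tJ.
Qed.

Lemma prec_iff1 n m v : sortable Om v -> (len v <= m)%N ->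
  prec n 1%g = v <->
  forall r, acyclic (r |: Jmax v)%SET -> pos (act 1^-1 (cvec m v r)).
Proof.
move=> hv lv; rewrite prec1 invg1; split=> [<- r ar|h].
  have J0 : Jmax 1%g = finset.set0 by apply/(fam1 B)/(Jmax_fam B).
  by rewrite cvec_out ?J0 ?inE // act1 gam_pos ?inE ?eqxx // -J0.
apply/esym/(Jmax_eq0 B)/(fam1 B)/(cvec_pos_fam hv lv) => r rJ.
by rewrite invg1; apply/h/acyclic_setU1_Jmax.
Qed.

Lemma prec_iff n m v w : sortable Om v -> (len w <= n)%N -> (len v <= m)%N ->
  prec n w = v <->
  forall r, acyclic (r |: Jmax v)%SET -> pos (act w^-1 (cvec m v r)).
Proof.
elim: n m v w => [|n IH] m v w hv lw lv.
  have -> : w = 1%g by apply: (@len_eq0 _ _ C); lia.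
  exact: prec_iff1.
have [->|w1] := eqVneq w 1%g; first exact: prec_iff1.
have lw2 : (len ((cOm (Jmax w))^-1 * parabolic_part C (Jmax w) w)%g <= n)%N.
  by have := len_proj_step w1; lia.
have aJ := Jmax_acyclic B Om w; have [_ hJ] := famP B _ _ _ (Jmax_fam B Om w).
have v1 : Jmax v = Jmax w -> v != 1%g.
  move=> E; apply: contra w1 => /eqP v1.
  have w0 : Jmax w = finset.set0 by rewrite -E v1; apply/(fam1 B)/(Jmax_fam B).
  by rewrite (Jmax_eq0 B w0).
have hv2 := sortable_step hv.
have cvecS m' r : (len v <= m'.+1)%N -> Jmax v = Jmax w -> r \in Jmax w ->
    pos (act ((cOm (Jmax w))^-1 * parabolic_part C (Jmax w) w)^-1 (cvec m' (step v) r))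
    = pos (act w^-1 (cvec m'.+1 v r)).
  move=> lv' E rJ; have J2 : Jmax (step v) \subset Jmax w by rewrite -E sortable_Jmax.
  have sx := supp_cvec B hv2 (step_fuel B Om lv') J2 aJ rJ.
  by rewrite (pos_proj_step (root_cvec B Om m' (step v) r) sx) /= E rJ.
rewrite precS //; split=> [vE|h].
  have E : Jmax v = Jmax w.
    have vE' : v = prec n.+1 w by rewrite precS.
    apply/eqP; rewrite finset.eqEsubset; apply/andP; split.
      by apply: (par_fam B _ (Jmax_fam B Om v)); rewrite vE'; exact: par_prec.
    apply: (fam_Jmax B); apply/(famP B); split=> // j jJ.
    have rg := root_gam B Om (Jmax w) j; have rc := root_act (cOm (Jmax w))^-1 rg.
    have /(famP B)[_ /(_ j jJ)] := fam_cOm aJ.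
    rewrite !phi_root // -(root_posN rc) => n1.
    rewrite -vE invgM actM -(root_posN (root_act _ rc)) -actN.
    apply: pos_prec n1 _; first exact: root_opp.
    rewrite pos_proj_step; last first.
    - by apply/suppN/par_act_supp/supp_gam => //; apply/parV/par_cOm.
    - exact: root_opp.
    by rewrite actN actVK actN (root_posN (root_act _ rg)) -phi_root ?hJ.
  case: m lv => [|m] lv r ar.
    by move: (v1 E); rewrite -(@len_eq0 _ _ C v) ?eqxx //; lia.
  have [rJ|rJ] := boolP (r \in Jmax v); last first.
    rewrite cvec_out //; apply: contraT => n1.
    have fv : fam w (Jmax v) by rewrite E; exact: (Jmax_fam B).
    have n2 : 0 < phi w (gam (r |: Jmax v)%SET r).
      by rewrite phi_root //; apply: root_gam.
    have := fam_Jmax B (fam_add ar fv n2).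
    by rewrite -E finset.subUset finset.sub1set (negPf rJ).
  have stE : step v = prec n ((cOm (Jmax w))^-1 * parabolic_part C (Jmax w) w)%g.
    by rewrite /sort_step E -vE mulKg.
  rewrite -cvecS -?E //; have /IH := hv2 => /(_ m _ lw2 (step_fuel B Om lv))[/(_ (esym stE))].
  rewrite E => h _; apply: h; apply: acyclicS (acyclic_setU1_Jmax rJ).
  by apply: finset.setUS; apply: sortable_Jmax.
have fv : fam w (Jmax v).
  by apply: (cvec_pos_fam hv lv) => r rJ; apply/h/acyclic_setU1_Jmax.
have E : Jmax v = Jmax w.
  apply: contrapT => /eqP ne.
  have pr : Jmax v \proper Jmax w by rewrite finset.properEneq ne (fam_Jmax B).
  have [r [rJ rv fr]] := fam_between fv (Jmax_fam B Om w) pr.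
  have [ar hr] := famP B _ _ _ fr; have := hr r; rewrite !inE eqxx => /(_ isT).
  rewrite phi_root; last exact: root_gam.
  by have := h r ar; rewrite cvec_out // => ->.
case: m lv h => [|m] lv h.
  by move: (v1 E); rewrite -(@len_eq0 _ _ C v) ?eqxx //; lia.
have /IH := hv2 => /(_ m _ lw2 (step_fuel B Om lv))[_ ->].
  by rewrite /sort_step E mulVKg.
move=> r ar; have [rJ|rJ] := boolP (r \in Jmax w).
  by rewrite cvecS //; apply: h; apply: acyclic_setU1_Jmax; rewrite E.
rewrite cvec_out; last first.
  by apply: contra rJ; rewrite -E; apply: (fintype.subsetP (sortable_Jmax hv)).
apply: (par_pos_out (parV (par_proj_step w)) _ rJ); first exact: root_gam.
by rewrite gam_coord1.
Qed.

Lemma pi_down_iff v w : sortable Om v ->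
  pi_down Om w = v <->
  forall r, acyclic (r |: Jmax v)%SET -> pos (act w^-1 (cvec (len v) v r)).
Proof. by move=> hv; apply: prec_iff. Qed.

End Projection.

(** * Sorting words *)

Section Greedy.
Variables (W : groupType) (S : finType) (C : coxeterSystem W S).
Local Notation wp := (word_prod (gen C)).
Local Notation len := (length C).
Variables (a : nat -> S) (v : W).

(* What remains of v after reading the first j letters and taking each one that
   shortens it. *)
Fixpoint rest j : W :=
  if j is j'.+1 then
    if desc C (a j') (rest j') then (gen C (a j') * rest j')%g else rest j'
  else v.

Definition taken j := desc C (a j) (rest j).

Lemma restS j : rest j.+1 = if taken j then (gen C (a j) * rest j)%g else rest j.
Proof. by []. Qed.

Lemma greedy_word k n : let P := [seq j <- iota k n | taken j] in
  (wp (map a P) * rest (k + n))%g = rest k /\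
  (size P + len (rest (k + n)))%N = len (rest k).
Proof.
elim: n k => [|n IH] k /=; first by rewrite addn0 wp_nil mul1g.
have [E1 E2] := IH k.+1; rewrite addSnnS in E1 E2.
have := restS k; case: ifP => tk rk /=; last by rewrite E1 E2 rk.
rewrite wp_cons -mulgA E1 addSn E2 rk genK; split=> //.
by rewrite (desc_len tk).
Qed.

Lemma greedy_min N k P : rest N = 1%g -> (k <= N)%N ->
  sorted ltn P -> all (leq k) P -> reduced_word_of C (rest k) (map a P) ->
  (([seq j <- iota k (N - k) | taken j] : seqlexi nat) <= (P : seqlexi nat))%O.
Proof.
move=> rN; move Nk: (N - k)%N => n; elim: n k Nk P => [|n IH] k Nk P kN sP kP rP.
  by rewrite /= lexi0s.
have Nk' : (N - k.+1)%N = n by lia.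
have kN' : (k < N)%N by lia.
have aboveS P' : all (leq k) P' -> k \notin P' -> all (leq k.+1) P'.
  move=> /allP h kP'; apply/allP => j jP; rewrite ltn_neqAle (h j jP) andbT.
  by apply: contraNneq kP' => ->.
have tkP x : x = k -> x :: drop 1 P = P -> taken k.
  move=> -> PE; rewrite /taken; have [<- sz] := rP.
  by move: sz; rewrite -PE => /(@desc_word _ _ C).
rewrite /=; case: ifP => tk; last first.
  apply: (IH k.+1) => //; last by rewrite restS tk.
  case: P sP kP rP tkP => // x P sP kP rP tkP; apply: (aboveS _ kP).
  have /= kx : x != k by apply/eqP => /tkP; rewrite /= drop0 tk => /(_ erefl).
  rewrite inE negb_or eq_sym kx /=; apply/negP => kP'.
  have := order_path_min ltn_trans sP => /allP/(_ k kP').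
  by case/andP: kP => kx' _; rewrite ltnNge kx'.
case: P sP kP rP tkP => [|x P] sP kP rP tkP.
  have [w1 _] := rP; move: tk; rewrite /taken -w1 wp_nil /desc len1 ltn0 //.
rewrite lexi_cons /= !leEnat; case/andP: kP => kx kP; rewrite kx /=.
apply/implyP => xk; have {kx xk} xk : x = k by apply/eqP; rewrite eqn_leq xk kx.
rewrite xk in sP rP; apply: (IH k.+1) => //; first exact: path_sorted sP.
  by apply: aboveS => //; apply/negP => /(allP (order_path_min ltn_trans sP)); rewrite ltnn.
have [w1 sz] := rP; rewrite restS tk; split.
  by rewrite -w1 wp_cons genK.
by apply/eqP; rewrite -eqSS -(desc_len tk) -sz.
Qed.

End Greedy.

Section Sorting_word.
Variables (R : realType) (W : groupType) (S : finType) (C : coxeterSystem W S).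
Variables (B : symCartan R C) (Om : orientation C).
Local Notation e := (simple_root R).
Local Notation wp := (word_prod (gen C)).
Local Notation g := (gen C).
Local Notation len := (length C).
Local Notation act := (act C B).
Local Notation desc := (desc C).
Local Notation gam := (gam B Om).
Local Notation acyclic := (acyclic Om).
Local Notation Jmax := (Jmax Om).
Local Notation step := (sort_step Om).
Local Notation cvec := (cvec B Om).
Local Open Scope ring_scope.
Implicit Types (J K L : {set S}) (s r : S) (p q : seq S) (u v w : W).



Lemma take_index_filter (P : pred S) q s : P s ->
  take (index s (seq.filter P q)) (seq.filter P q) = seq.filter P (take (index s q) q).
Proof.
move=> Ps; elim: q => //= t q IH; have [->|ts] := eqVneq t s.
  by rewrite Ps /= eqxx.
by case: ifP => Pt /=; rewrite ?(negPf ts) /= ?IH Pt.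
Qed.

Lemma block_prefix_root K J q s : acyclic K -> topo Om q -> q =i K ->
  J \subset K -> s \in K ->
  act (wp [seq t <- take (index s q) q | t \in J]) (e s) = gam (s |: J)%SET s.
Proof.
move=> aK tq qK JK sK; have aJ : acyclic (s |: J)%SET.
  by apply: acyclicS aK; rewrite finset.subUset finset.sub1set sK.
have pE : [seq t <- q | t \in (s |: J)%SET] =i (s |: J)%SET.
  move=> t; rewrite mem_filter; case tJ : (_ \in _) => //=; rewrite qK.
  by move: tJ; rewrite !inE => /predU1P[->//|]; apply: (fintype.subsetP JK).
rewrite -(prefix_root_gam B (topo_filter _ tq) pE aJ); last by rewrite !inE eqxx.
rewrite /prefix_root take_index_filter; last by rewrite !inE eqxx.
congr (act (wp _) _); apply: eq_in_filter => t tt; rewrite !inE.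
case: eqP => [ts|//]; move: tt; rewrite ts in_take ?ltnn //.
by rewrite qK.
Qed.

Lemma block_desc K q u s : acyclic K -> topo Om q -> q =i K ->
  Jmax u \subset K -> s \in K ->
  desc s ((wp [seq t <- take (index s q) q | t \in Jmax u])^-1 * u)%g = (s \in Jmax u).
Proof.
move=> aK tq qK JK sK; rewrite (desc_pos B) invgM invgK actM (block_prefix_root aK) //.
rewrite -phi_root; last exact: root_gam.
have fJ := Jmax_fam B Om u.
have [sJ|sJ] := boolP (s \in Jmax u).
  have -> : (s |: Jmax u = Jmax u)%SET by apply/finset.setUidPr; rewrite finset.sub1set.
  by have [_ ->] := famP B _ _ _ fJ.
apply/negP => h; have aJ : acyclic (s |: Jmax u)%SET.
  by apply: acyclicS aK; rewrite finset.subUset finset.sub1set sK.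
have := fam_Jmax B (fam_add aJ fJ h).
by rewrite finset.subUset finset.sub1set (negPf sJ).
Qed.

Lemma sortable_iter v i : sortable Om v -> Jmax (iter i step v) \subset Jmax v.
Proof.
move=> hv; elim: i => [|i IH]; first exact: fintype.subxx.
exact: fintype.subset_trans (hv i) IH.
Qed.

Lemma len_iter v i n : (len v <= n + i)%N -> (len (iter i step v) <= n)%N.
Proof.
elim: i v => [|i IH] v; first by rewrite addn0.
by rewrite addnS => lv; rewrite iterSr; apply: IH; apply: (step_fuel B).
Qed.

Lemma cvec_iter n v r k : (k <= n)%N ->
  (forall i, (i < k)%N -> r \in Jmax (iter i step v)) -> r \notin Jmax (iter k step v) ->
  cvec n v r = act (v * (iter k step v)^-1)%g (gam (r |: Jmax (iter k step v))%SET r).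
Proof.
elim: n v k => [|n IH] v [|k] // kn h rk; rewrite ?(cvec_out _ _ rk) ?mulgV ?act1 //.
have r0 := h 0%N isT; rewrite /= r0 (IH _ k) //; last by rewrite -iterSr.
  by rewrite -actM mulgA -iterSr /sort_step mulVKg.
by move=> i ik; rewrite -iterSr; apply: h.
Qed.

Section Blocks.
Variables (v : W) (r : S) (K : {set S}).
Hypotheses (hv : sortable Om v) (aK : acyclic K) (vK : Jmax v \subset K) (rK : r \in K).
Let q := cword Om K.
Let n := size q.
Let a := letter q r.
Local Notation vi i := (iter i step v).

Lemma block_n_gt0 : (0 < n)%N.
Proof.
have [_ qK] := cwordP aK; rewrite lt0n.
by apply: contraTneq rK => /size0nil; rewrite -qK -/q => ->.
Qed.

Lemma block_letter i t : (t < n)%N -> a (i * n + t) = nth r q t.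
Proof. by move=> tn; rewrite /a /letter modnMDl modn_small. Qed.

Lemma block_Jmax i : Jmax (vi i) \subset K.
Proof. exact: fintype.subset_trans (sortable_iter i hv) vK. Qed.

Lemma block_rest_taken i t : (t <= n)%N ->
  rest C a v (i * n + t) = ((wp [seq s <- take t q | s \in Jmax (vi i)])^-1 * vi i)%g /\
  ((t < n)%N -> taken C a v (i * n + t) = (nth r q t \in Jmax (vi i))).
Proof.
have [tq qK] := cwordP aK; have /andP[uq _] := tq.
have tkE j (l : nat) : (l < n)%N -> rest C a v (j * n + l) =
      ((wp [seq s <- take l q | s \in Jmax (vi j)])^-1 * vi j)%g ->
    taken C a v (j * n + l) = (nth r q l \in Jmax (vi j)).
  move=> sn E; rewrite /taken E block_letter // -{2}(index_uniq r sn uq).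
  by rewrite (block_desc aK tq qK) ?block_Jmax // -qK mem_nth.
elim: i t => [|i IHi] t.
  elim: t => [|t IHt] tn.
    rewrite take0 wp_nil invg1 mul1g; split=> // n0.
    by apply: tkE; rewrite // take0 wp_nil invg1 mul1g.
  have [E /(_ tn) tk] := IHt (ltnW tn).
  have E' : rest C a v (0 * n + t.+1) =
      ((wp [seq s <- take t.+1 q | s \in Jmax (vi 0)])^-1 * vi 0)%g.
    rewrite addnS restS tk E block_letter // (take_nth r) // filter_rcons.
    by case: ifP => // _; rewrite wp_rcons invgM genV mulgA.
  by split=> // tn'; apply: tkE.
elim: t => [|t IHt] tn.
  have E' : rest C a v (i.+1 * n + 0) =
      ((wp [seq s <- take 0 q | s \in Jmax (vi i.+1)])^-1 * vi i.+1)%g.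
    have [E _] := IHi n (leqnn n); rewrite addn0 mulSn addnC E take_size take0 wp_nil.
    rewrite invg1 mul1g iterS /sort_step; congr (_^-1 * _)%g.
    apply: (topo_word_cOm B); first exact: (Jmax_acyclic B).
      exact: topo_filter.
    move=> s; rewrite mem_filter andbC qK.
    by apply/andP/idP => [[]|sJ] //; rewrite (fintype.subsetP (block_Jmax i)).
  by split=> // tn'; apply: tkE.
have [E /(_ tn) tk] := IHt (ltnW tn).
have E' : rest C a v (i.+1 * n + t.+1) =
    ((wp [seq s <- take t.+1 q | s \in Jmax (vi i.+1)])^-1 * vi i.+1)%g.
  rewrite addnS restS tk E block_letter // (take_nth r) // filter_rcons.
  by case: ifP => // _; rewrite wp_rcons invgM genV mulgA.
by split=> // tn'; apply: tkE.
Qed.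

Lemma Cvec_word_cvec : Cvec_word C B q v r = cvec (len v) v r.
Proof.
have [tq qK] := cwordP aK; have /andP[uq _] := tq; have n0 := block_n_gt0.
have J0 : Jmax (vi (len v)) = finset.set0 by apply: (len0_Jmax B); apply: len_iter.
have ex : exists i, r \notin Jmax (vi i) by exists (len v); rewrite J0 inE.
case: (ex_minnP ex) => k rk kmin.
have kl : (k <= len v)%N by apply: kmin; rewrite J0 inE.
have h i : (i < k)%N -> r \in Jmax (vi i).
  by move=> ik; apply: contraLR ik; rewrite -leqNgt; apply: kmin.
rewrite (cvec_iter kl h rk).
have rq : (index r q < n)%N by rewrite index_mem qK.
pose N := ((len v).+1 * n)%N; pose j0 := (k * n + index r q)%N.
have j0N : (j0 < N)%N by rewrite /j0 /N; nia.
have restN : rest C a v N = 1%g.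
  have := block_rest_taken (len v).+1 (leq0n n); rewrite addn0 take0 wp_nil invg1 mul1g.
  case=> -> _; apply: (@len_eq0 _ _ C); apply/eqP; rewrite -leqn0.
  by apply: len_iter; rewrite add0n.
pose P := [seq j <- iota 0 N | taken C a v j].
have [gw gs] := greedy_word C a v 0 N; rewrite add0n restN mulg1 len1 addn0 in gw gs.
have sP : sorted ltn P by apply: sorted_filter (iota_ltn_sorted _ _); apply: ltn_trans.
have rP : reduced_positions C q r v P by split=> //; split=> //; rewrite size_map.
have minP P' : reduced_positions C q r v P' -> ((P : seqlexi nat) <= (P' : seqlexi nat))%O.
  move=> [sP' rP']; have := greedy_min restN (leq0n N) sP' _ rP'; rewrite subn0; apply.
  exact/allP.
have PE : sorting_positions C q r v = P.
  rewrite /sorting_positions; apply: xget_unique; first by split.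
  move=> P' [rP' minP']; apply: (@le_anti _ (seqlexi nat)).
  by rewrite minP // minP'.
have inP j : (j \in P) = (j < N)%N && taken C a v j.
  by rewrite mem_filter mem_iota add0n andbC.
have tj0 : taken C a v j0 = (r \in Jmax (vi k)).
  by have [_ /(_ rq) ->] := block_rest_taken k (ltnW rq); rewrite nth_index // qK.
have lj0 : letter q r j0 = r by rewrite -/a block_letter // nth_index // qK.
have j0min j : letter q r j = r -> j \notin P -> (j0 <= j)%N.
  move=> lj; rewrite inP (leqNgt j0); apply: contraNN => jj0.
  rewrite (ltn_trans jj0 j0N) /=; rewrite (divn_eq j n) in jj0 lj *.
  have tn : (j %% n < n)%N by rewrite ltn_mod.
  rewrite -/a block_letter // in lj.
  have tE : (j %% n)%N = index r q by rewrite -{1}lj index_uniq.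
  have [_ /(_ tn) ->] := block_rest_taken (j %/ n) (ltnW tn); rewrite lj; apply: h.
  by move: jj0; rewrite /j0 tE ltn_add2r ltn_pmul2r.
have skipE : first_skip q r P = j0.
  rewrite /first_skip; apply: xget_unique.
    by split=> //; rewrite inP tj0 (negPf rk) andbF.
  move=> y [ly yP ymin]; apply/eqP; rewrite eqn_leq (j0min y ly yP) andbT.
  by apply: ymin => //; rewrite inP tj0 (negPf rk) andbF.
rewrite /Cvec_word PE skipE.
have -> : [seq i <- P | (i < j0)%N] = [seq j <- iota 0 j0 | taken C a v j].
  rewrite /P -filter_predI -[N](subnKC (ltnW j0N)) iotaD filter_cat add0n.
  rewrite [X in _ ++ X](_ : _ = [::]) ?cats0.
    apply: eq_in_filter => j; rewrite mem_iota add0n /= => ->.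
    by rewrite ?andbT.
  rewrite -(filter_pred0 (iota j0 (N - j0))); apply: eq_in_filter => j.
  by rewrite mem_iota => /andP[jj _] /=; rewrite ltnNge jj.
have [gw' _] := greedy_word C a v 0 j0; rewrite add0n in gw'.
have [rj0 _] := block_rest_taken k (ltnW rq).
have -> : wp [seq letter q r i | i <- iota 0 j0 & taken C a v i] = (v * (rest C a v j0)^-1)%g.
  by apply: (canRL (mulgK _)); exact: gw'.
rewrite rj0 invgM invgK mulgA [LHS]actM (block_prefix_root aK tq qK (block_Jmax k) rK).
by [].
Qed.

End Blocks.

End Sorting_word.

(** * Chambers and rescaling *)

Section Chambers.
Variables (R : realType) (W : groupType) (S : finType) (C : coxeterSystem W S).
Variable A : S -> S -> R.
Local Notation V := (rootV S R).
Local Open Scope ring_scope.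

Definition coordinate (s : S) (x : V) : R^o := x s.

Fact coordinate_linear s : linear (coordinate s).
Proof. by move=> a x y; rewrite /coordinate !ffunE. Qed.

HB.instance Definition _ s :=
  GRing.isLinear.Build R V R^o *:%R (coordinate s) (coordinate_linear s).

Lemma chamber_subset_cone (Om : orientation C) v w :
  (dual_act C A w @` dominant (S := S) (R := R) `<=` Cone Om A v)%classic <->
  forall r b, Cvec Om A v r = Some b -> pos (act C A w^-1 b).
Proof.
split=> [h r b rb|h x [y hy <-] r b rb].
  apply/posP => s; have := h (dual_act C A w (linfun (coordinate s))) _ r b rb.
  rewrite /dual_act comp_lfunE lfunE; apply; exists (linfun (coordinate s)) => //.
  by move=> t; rewrite lfunE /= /coordinate ffunE ler0n.
rewrite /dual_act comp_lfunE; have /posP p := h r b rb.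
rewrite (rootV_sum (act C A w^-1 b)) linear_sum; apply: sumr_ge0 => s _.
by rewrite linearZ; apply: mulr_ge0; [apply: p | apply: hy].
Qed.

End Chambers.

Section Symmetrize.
Variables (R : realType) (W : groupType) (S : finType) (C : coxeterSystem W S).
Variables (A : S -> S -> R) (hA : symmetrizable_cartan C A).
Local Notation V := (rootV S R).
Local Notation e := (simple_root R).
Local Open Scope ring_scope.

Lemma symmetrize : exists (d : S -> R) (B : symCartan R C),
  (forall s, 0 < d s) /\ forall s t, B s t * d s = A s t * d t.
Proof.
have [delta [d0 dA _]] := cartan_symm hA.
pose d s := Num.sqrt (delta s)^-1.
have dp s : 0 < d s by rewrite sqrtr_gt0 invr_gt0.
have dn s : d s != 0 by rewrite gt_eqF.
have d2 s : d s ^+ 2 = (delta s)^-1 by rewrite sqr_sqrtr // invr_ge0 ltW.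
pose B s t := A s t * d t / d s.
have BB s t : B s t * B t s = A s t * A t s.
  by rewrite /B; field; rewrite !dn.
have symB s t : B s t = B t s.
  have E : A s t * d t ^+ 2 = A t s * d s ^+ 2.
    have := dA s t; rewrite !d2 => E.
    have ns : delta s != 0 by rewrite gt_eqF.
    have nt : delta t != 0 by rewrite gt_eqF.
    by apply: (mulfI ns); rewrite mulrA E; field; rewrite ns nt.
  apply: (mulIf (dn s)); apply: (mulIf (dn t)).
  have -> : B s t * d s * d t = A s t * d t ^+ 2 by rewrite /B; field.
  by rewrite E /B; field.
have hB : symmetrizable_cartan C B.
  split.
  - by move=> s; rewrite /B (cartan_diag hA) mulfK.
  - move=> s t st; rewrite /B; apply: mulr_le0_ge0; last by rewrite invr_ge0 ltW.
    by apply: mulr_le0_ge0; [exact: cartan_offdiag hA _ _ st | exact: ltW].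
  - by move=> s t st m0; rewrite BB; apply: cartan_finite hA _ _ st m0.
  - by move=> s t st m0; rewrite BB; apply: cartan_infinite hA _ _ st m0.
  - by move=> s t; rewrite symB.
  - by exists (fun=> 1); split=> // s t; rewrite symB.
by exists d, (SymCartan hB symB); split=> // s t; rewrite /= /B mulfVK.
Qed.

Variables (d : S -> R) (B : symCartan R C).
Hypotheses (d_gt0 : forall s, 0 < d s) (Bd : forall s t, B s t * d s = A s t * d t).

Definition rescale (x : V) : V := [ffun s => x s * d s].

Lemma word_act_rescale u x : word_act A u (rescale x) = rescale (word_act B u x).
Proof.
elim: u => [|s u IH]; first by rewrite !word_act_nil.
rewrite !word_act_cons IH !refl_formE !bil_el; apply/ffunP => t.
rewrite !ffunE /GRing.scale /= mulrBl; congr (_ - _).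
have [->|ts] := eqVneq t s; last by rewrite !mulr0 mul0r.
rewrite !mulr1 mulr_suml; apply: eq_bigr => r _.
by rewrite !ffunE mulrCA -Bd; ring.
Qed.

Lemma pos_act_rescale a b r :
  pos (act C A a (act C A b (e r))) = pos (act C B a (act C B b (e r))).
Proof.
have dn s : d s != 0 by rewrite gt_eqF.
have E : e r = (d r)^-1 *: rescale (e r).
  apply/ffunP => s; rewrite !ffunE /GRing.scale /=.
  by have [->|_] := eqVneq s r; rewrite ?mul0r ?mulr0 // mul1r mulVf.
rewrite [in LHS]E [act C A b _]linearZ [act C A a _]linearZ /=.
rewrite /act !word_act_rescale.
set x := word_act _ _ _; apply/posP/posP => h s; have := h s;
  by rewrite !ffunE /GRing.scale /= pmulr_rge0 ?invr_gt0 // pmulr_lge0.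
Qed.

End Symmetrize.

Unset Implicit Arguments.
Set Strict Implicit.
Local Open Scope classical_set_scope.

Theorem theorem4p1 (R : realType) (W : groupType) (S : finType)
    (C : coxeterSystem W S) (A : S -> S -> R)
    (hA : symmetrizable_cartan C A) (Om : orientation C) (v w : W)
    (hv : sortable Om v) :
  pi_down Om w = v <->
  dual_act C A w @` dominant (S := S) (R := R) `<=` Cone Om A v.
Proof.
have [d [B [d0 Bd]]] := symmetrize hA.
rewrite chamber_subset_cone (pi_down_iff B w hv).
have CE r : acyclic Om (r |: Jmax Om v)%SET ->
    Cvec_word C B (cword Om (r |: Jmax Om v)%SET) v r = cvec B Om (length C v) v r.
  by move=> aK; apply: Cvec_word_cvec => //; [exact: finset.subsetUr | rewrite !inE eqxx].
split=> [h r b|h r aK].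
  rewrite /Cvec; case: ifP => // aK [<-].
  by rewrite /Cvec_word (pos_act_rescale d0 Bd) -/(Cvec_word C B _ v r) CE //; apply: h.
rewrite -CE // /Cvec_word -(pos_act_rescale d0 Bd); apply: (h r).
by rewrite /Cvec aK.
Qed.
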